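(* Let $p>2$ be a prime, $\mathbf{F}$ a field of characteristic $p$, and $m\ge 0$, $\ell\ge 1$ integers. Choose a basis $\{X_i,Y_i\mid i=1,\ldots,m\}\cup\{X_i,Y_i,Z_i\mid i=m+1,\ldots,m+\ell\}$ of $(mV_2\oplus \ell V_3)^*$ with $\Delta(Z_i)=Y_i$ (for $i>m$), $\Delta(Y_i)=X_i$ and $\Delta(X_i)=0$, and use the graded reverse lexicographic order with $X_i<Y_i<Z_i<X_{i+1}$ (where $Z_i$ is omitted for $i\le m$). Then a reduced Gröbner basis for the Hilbert ideal of $mV_2\oplus\ell V_3$ is given by $$\{X_i, Y_i^p\mid i=1,\ldots,m\}\cup\{X_i, Y_iY_j,Z_i^p\mid i=m+1,\ldots,m+\ell;\ i\leq j\le m+\ell\};$$ the corresponding monomial basis for $\mathbf{F}[mV_2\oplus\ell V_3]_{\mathbf{Z}/p}$ is given by the monomial factors (divisors) of $y_j(y_1\cdots y_m z_{m+1}\cdots z_{m+\ell})^{p-1}$ for $j=m+1,\ldots,m+\ell$; and the Hilbert series of $\mathbf{F}[mV_2\oplus\ell V_3]_{\mathbf{Z}/p}$ is $(\ell t+1)(1+t+\cdots+t^{p-1})^{m+\ell}$. Furthermore, both as $\mathbf{F}$-algebras and as $\mathbf{F}\mathbf{Z}/p$-modules, $\mathbf{F}[mV_2\oplus\ell V_3]_{\mathbf{Z}/p}\cong\mathbf{F}[mV_2]_{\mathbf{Z}/p}\otimes\mathbf{F}[\ell V_3]_{\mathbf{Z}/p}$.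
   Context: For $n\le p$, $V_n$ is the $n$-dimensional indecomposable representation over $\mathbf{F}$ of the cyclic group $\mathbf{Z}/p=\langle\sigma\rangle$ on which $\sigma$ acts by a single Jordan block with eigenvalue $1$; $mV_n$ is the direct sum of $m$ copies. For a representation $V$, the action on $V^*$ extends to algebra automorphisms of $\mathbf{F}[V]=S(V^* )$; $\Delta:=\sigma-1$. The Hilbert ideal is the ideal of $\mathbf{F}[V]$ generated by all homogeneous invariants of positive degree, and the ring of coinvariants $\mathbf{F}[V]_{\mathbf{Z}/p}$ is the quotient of $\mathbf{F}[V]$ by the Hilbert ideal, with its induced grading and $\mathbf{Z}/p$-action. Lower case letters denote images in the coinvariants of the variables written in upper case. The monomial basis corresponding to a Gröbner basis consists of the images of the monomials not divisible by any leading monomial of the Gröbner basis. *)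

(* Defs.v *)
From HB Require Import structures.
From mathcomp Require Import all_boot all_order all_algebra.
From mathcomp Require Import boolp.
From mathcomp Require Import mpoly.

Set Implicit Arguments.
Unset Strict Implicit.
Unset Printing Implicit Defensive.

Import GRing.Theory.
Local Open Scope ring_scope.
Local Open Scope quotient_scope.

Section LinearAlgebra.
Variables (F : fieldType) (L : lmodType F).

(* The family e, indexed by the i with P i, is a basis of the subspace W. *)
Definition is_basis (I : eqType) (W : L -> Prop) (P : I -> Prop)
    (e : I -> L) : Prop :=
  [/\ forall i, P i -> W (e i),
      forall (s : seq I) (c : I -> F), uniq s -> {in s, forall i, P i} ->
        \sum_(i <- s) c i *: e i = 0 -> {in s, forall i, c i = 0}
    & forall x, W x -> exists (s : seq I) (c : I -> F),
        {in s, forall i, P i} /\ x = \sum_(i <- s) c i *: e i].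

Definition has_dim (W : L -> Prop) (d : nat) : Prop :=
  exists e : 'I_d -> L, is_basis W (fun=> True) e.

End LinearAlgebra.

Section GeneratedIdeal.
Variable R : nzRingType.

(* The left ideal generated by S; only used for commutative R. *)
Definition ideal_gen (S : R -> Prop) (f : R) : Prop :=
  exists s : seq (R * R),
    {in s, forall x, S x.2} /\ f = \sum_(x <- s) x.1 * x.2.

End GeneratedIdeal.

Section GroebnerBases.
Variables (F : fieldType) (n : nat).
Implicit Types (a b : 'X_{1..n}) (f g : {mpoly F[n]}).

(* Graded reverse lexicographic order for which the variable of index 0 is the
   smallest one: in equal degree, the larger exponent at the smallest variable
   where a and b differ makes the smaller monomial. *)
Definition grevlex_lt a b : bool :=
  (mdeg a < mdeg b)%N ||
  (mdeg a == mdeg b) &&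
  [exists i : 'I_n, (b i < a i)%N && [forall j : 'I_n, (j < i)%N ==> (a j == b j)]].

(* The monomial 0%MM is the least one, so it is a neutral start of the
   iterated maximum; lead_mon 0 is the junk value 0%MM. *)
Definition lead_mon f : 'X_{1..n} :=
  \big[(fun a b => if grevlex_lt a b then b else a)/0%MM]_(a <- msupp f) a.

Definition lead_ideal (S : {mpoly F[n]} -> Prop) : {mpoly F[n]} -> Prop :=
  ideal_gen (fun h => exists f, [/\ S f, f != 0 & h = 'X_[lead_mon f]]).

Definition groebner_basis (I : {pred {mpoly F[n]}}) (G : seq {mpoly F[n]}) : Prop :=
  {subset G <= I} /\
  forall h, lead_ideal (fun f => f \in I) h <-> lead_ideal (fun f => f \in G) h.

Definition reduced_groebner_basis (I : {pred {mpoly F[n]}})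
    (G : seq {mpoly F[n]}) : Prop :=
  groebner_basis I G /\
  {in G, forall g, g@_(lead_mon g) = 1 /\
    {in msupp g, forall a, ~ lead_ideal (fun f => f \in G /\ f != g) 'X_[a]}}.

(* For a monomial basis: a is divisible by no leading monomial of G. *)
Definition standard_mon (G : seq {mpoly F[n]}) a : Prop :=
  {in G, forall g, ~~ (lead_mon g <= a)%MM}.

End GroebnerBases.

Section Coinvariants.
Variables (F : fieldType) (n : nat).

(* M is the matrix of sigma on V^* in the basis of V^* given by the variables:
   sigma X_i = sum_j M i j X_j. *)
Variable M : 'M[F]_n.

Definition sigma (f : {mpoly F[n]}) : {mpoly F[n]} :=
  f \mPo [tuple \sum_(j < n) M i j *: 'X_j | i < n].

HB.instance Definition _ := GRing.LRMorphism.copy sigma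
  (comp_mpoly [tuple \sum_(j < n) M i j *: 'X_j | i < n]).

Definition homog_invariant_pos (f : {mpoly F[n]}) : Prop :=
  sigma f = f /\ exists2 d, (0 < d)%N & f \is d.-homog.

Definition hilbert_ideal : {pred {mpoly F[n]}} :=
  fun f => `[< ideal_gen homog_invariant_pos f >].

Lemma hilbert_idealP f :
  reflect (ideal_gen homog_invariant_pos f) (f \in hilbert_ideal).
Proof. exact: asboolP. Qed.

Lemma hilbert_ideal_closed : idealr_closed hilbert_ideal.
Proof.
split.
- by apply/hilbert_idealP; exists [::]; rewrite big_nil.
- apply/negP => /hilbert_idealP [s [sS /(congr1 (fun f => f@_0%MM))]].
  rewrite mcoeff1 eqxx raddf_sum /= big_seq big1 => [/eqP|x /sS].
    by rewrite oner_eq0.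
  case=> _ [d d0 xd]; rewrite rmorphM /=.
  suff -> : x.2@_0%MM = 0 by rewrite mulr0.
  by apply: (dhomog_nemf_coeff xd); rewrite /= mdeg0 eq_sym -lt0n.
- move=> a u v /hilbert_idealP [s [sS ->]] /hilbert_idealP [t [tS ->]].
  apply/hilbert_idealP; exists ([seq (a * x.1, x.2) | x <- s] ++ t); split.
    move=> x; rewrite mem_cat => /orP[/mapP[y ys ->]|]; last exact: tS.
    exact: sS ys.
  rewrite big_cat big_map /= mulr_sumr; congr (_ + _).
  by apply: eq_bigr => x _; rewrite mulrA.
Qed.

HB.instance Definition _ :=
  isIdealr.Build {mpoly F[n]} hilbert_ideal hilbert_ideal_closed.

Definition coinv : Type := {ideal_quot hilbert_ideal}.

HB.instance Definition _ := GRing.ComNzRing.on coinv.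
HB.instance Definition _ := NzRingQuotient.on coinv.

Definition coinv_scale (c : F) (x : coinv) : coinv := \pi_coinv c%:MP * x.

Fact coinv_scaleA c d x :
  coinv_scale c (coinv_scale d x) = coinv_scale (c * d) x.
Proof. by rewrite /coinv_scale mulrA mpolyCM rmorphM. Qed.

Fact coinv_scale1 : left_id 1 coinv_scale.
Proof. by move=> x; rewrite /coinv_scale mpolyC1 rmorph1 mul1r. Qed.

Fact coinv_scaleDr : right_distributive coinv_scale +%R.
Proof. by move=> c x y; rewrite /coinv_scale mulrDr. Qed.

Fact coinv_scaleDl x : {morph coinv_scale^~ x : c d / c + d}.
Proof. by move=> c d; rewrite /coinv_scale mpolyCD rmorphD mulrDl. Qed.

HB.instance Definition _ := GRing.Zmodule_isLmodule.Build F coinv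
  coinv_scaleA coinv_scale1 coinv_scaleDr coinv_scaleDl.

Fact coinv_scaleAl c (x y : coinv) : c *: (x * y) = (c *: x) * y.
Proof. exact: mulrA. Qed.

HB.instance Definition _ := GRing.Lmodule_isLalgebra.Build F coinv coinv_scaleAl.

Fact coinv_scaleAr c (x y : coinv) : c *: (x * y) = x * (c *: y).
Proof. by rewrite ![x * _]mulrC coinv_scaleAl. Qed.

HB.instance Definition _ := GRing.Lalgebra_isAlgebra.Build F coinv coinv_scaleAr.

Definition to_coinv (f : {mpoly F[n]}) : coinv := \pi_coinv f.

HB.instance Definition _ := GRing.RMorphism.copy to_coinv \pi_coinv.

Fact to_coinv_is_scalable : scalable to_coinv.
Proof. by move=> c f; rewrite -mul_mpolyC rmorphM. Qed.

HB.instance Definition _ :=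
  GRing.isScalable.Build F {mpoly F[n]} coinv *:%R to_coinv to_coinv_is_scalable.

Definition coinv_sigma (x : coinv) : coinv := to_coinv (sigma (repr x)).

Lemma sigma_hilbert_ideal f : f \in hilbert_ideal -> sigma f \in hilbert_ideal.
Proof.
case/hilbert_idealP => s [sS ->]; apply/hilbert_idealP.
exists [seq (sigma x.1, x.2) | x <- s]; split.
  by move=> z /mapP[y ys ->]; exact: sS ys.
rewrite big_map raddf_sum; apply: eq_big_seq => x /sS [xE _].
by rewrite /= rmorphM /= xE.
Qed.

Lemma coinv_sigmaE f : coinv_sigma (to_coinv f) = to_coinv (sigma f).
Proof.
apply/eqP; rewrite /coinv_sigma /to_coinv -Quotient.idealrBE -rmorphB.
by apply: sigma_hilbert_ideal; rewrite Quotient.idealrBE reprK.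
Qed.

Lemma to_coinvK (x : coinv) : to_coinv (repr x) = x.
Proof. exact: reprK. Qed.

Fact coinv_sigma_is_zmod_morphism : zmod_morphism coinv_sigma.
Proof.
move=> x y; rewrite -[x]to_coinvK -[y]to_coinvK -rmorphB.
by rewrite !coinv_sigmaE !rmorphB.
Qed.

Fact coinv_sigma_is_monoid_morphism : monoid_morphism coinv_sigma.
Proof.
split=> [|x y].
  by rewrite -[X in coinv_sigma X](rmorph1 to_coinv) coinv_sigmaE !rmorph1.
rewrite -[x]to_coinvK -[y]to_coinvK -rmorphM.
by rewrite !coinv_sigmaE !rmorphM.
Qed.

Fact coinv_sigma_is_scalable : scalable coinv_sigma.
Proof.
move=> c x; rewrite -[x]to_coinvK -linearZ /= !coinv_sigmaE.
by rewrite [sigma _]linearZ [to_coinv _]linearZ.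
Qed.

HB.instance Definition _ :=
  GRing.isZmodMorphism.Build coinv coinv coinv_sigma coinv_sigma_is_zmod_morphism.
HB.instance Definition _ :=
  GRing.isMonoidMorphism.Build coinv coinv coinv_sigma coinv_sigma_is_monoid_morphism.
HB.instance Definition _ :=
  GRing.isScalable.Build F coinv coinv *:%R coinv_sigma coinv_sigma_is_scalable.

Definition coinv_deg (d : nat) (x : coinv) : Prop :=
  exists2 f : {mpoly F[n]}, f \is d.-homog & x = to_coinv f.

(* H is a polynomial, so that its coefficients vanish in large degrees. *)
Definition coinv_hilbert_series (H : {poly nat}) : Prop :=
  forall d, has_dim (coinv_deg d) (H`_d)%R.

End Coinvariants.

Section Tensor.
Variables (F : fieldType).

Definition is_bilinear (A B W : lmodType F) (b : A -> B -> W) : Prop :=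
  (forall y, linear (b^~ y)) /\ (forall x, linear (b x)).

Section Construction.
Variables A B : lmodType F.

(* A list of pairs stands for the formal sum of the corresponding pure tensors;
   beval b is the map induced on formal sums by a bilinear map b. *)
Definition beval (W : lmodType F) (b : A -> B -> W) (s : seq (A * B)) : W :=
  \sum_(x <- s) b x.1 x.2.

(* Two formal sums of pure tensors define the same tensor when no bilinear map
   to a vector space separates them; tensor_lift and tensor_lift_unique below
   are the resulting universal property. *)
Definition tensor_eq (s t : seq (A * B)) : bool :=
  `[< forall (W : lmodType F) (b : A -> B -> W),
        is_bilinear b -> beval b s = beval b t >].

Fact tensor_eq_equiv : equiv_class_of tensor_eq.
Proof.
split=> [s|s t|t s u]; first exact/asboolP.
  by apply/asboolP/asboolP => h W b /h.
move=> /asboolP h1 /asboolP h2; apply/asboolP => W b hb.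
by rewrite h1 // h2.
Qed.

Canonical tensor_equiv := EquivRelPack tensor_eq_equiv.
Canonical tensor_encModRel := defaultEncModRel tensor_eq.

Definition tensor : Type := {eq_quot tensor_eq}.
HB.instance Definition _ : EqQuotient _ tensor_eq tensor := EqQuotient.on tensor.
HB.instance Definition _ := Choice.on tensor.

Definition tsum (s : seq (A * B)) : tensor := \pi_tensor s.
Definition pure (x : A) (y : B) : tensor := tsum [:: (x, y)].

Lemma tsumP s t : reflect
  (forall (W : lmodType F) (b : A -> B -> W),
     is_bilinear b -> beval b s = beval b t) (tsum s == tsum t).
Proof. by rewrite /tsum piE; apply: asboolP. Qed.

Definition tensor_lift (W : lmodType F) (b : A -> B -> W) (t : tensor) : W :=
  beval b (repr t).

Lemma tensor_lift_tsum (W : lmodType F) (b : A -> B -> W) s :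
  is_bilinear b -> tensor_lift b (tsum s) = beval b s.
Proof. by move=> hb; apply/(tsumP _ s): hb; rewrite /tsum reprK. Qed.

Lemma tensor_ext (t u : tensor) :
  (forall (W : lmodType F) (b : A -> B -> W),
     is_bilinear b -> tensor_lift b t = tensor_lift b u) -> t = u.
Proof.
by move=> h; rewrite -[t]reprK -[u]reprK; apply/eqP/tsumP => W b /h.
Qed.

Definition tensor_zero : tensor := tsum [::].
Definition tensor_add (t u : tensor) : tensor := tsum (repr t ++ repr u).
Definition tensor_scale (c : F) (t : tensor) : tensor :=
  tsum [seq (c *: x.1, x.2) | x <- repr t].
Definition tensor_opp : tensor -> tensor := tensor_scale (-1).

Section Lift.
Variables (W : lmodType F) (b : A -> B -> W).
Hypothesis hb : is_bilinear b.

Lemma bilinearZl c x y : b (c *: x) y = c *: b x y.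
Proof.
have h := hb.1 y.
have b0 : b 0 y = 0.
  by have /eqP := h 1 0 0; rewrite !scale1r addr0 -subr_eq subrr => /eqP.
by have := h c x 0; rewrite /= !addr0 b0 addr0.
Qed.

Lemma lift_zero : tensor_lift b tensor_zero = 0.
Proof. by rewrite tensor_lift_tsum // /beval big_nil. Qed.

Lemma lift_add t u : tensor_lift b (tensor_add t u) = tensor_lift b t + tensor_lift b u.
Proof. by rewrite tensor_lift_tsum // /beval big_cat. Qed.

Lemma lift_scale c t : tensor_lift b (tensor_scale c t) = c *: tensor_lift b t.
Proof.
rewrite tensor_lift_tsum // /beval big_map scaler_sumr.
by apply: eq_bigr => x _; rewrite bilinearZl.
Qed.

End Lift.

Fact tensor_addA : associative tensor_add.
Proof. by move=> t u v; apply: tensor_ext => W b hb; rewrite !lift_add // addrA. Qed.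

Fact tensor_addC : commutative tensor_add.
Proof. by move=> t u; apply: tensor_ext => W b hb; rewrite !lift_add // addrC. Qed.

Fact tensor_add0 : left_id tensor_zero tensor_add.
Proof.
by move=> t; apply: tensor_ext => W b hb; rewrite lift_add // lift_zero // add0r.
Qed.

Fact tensor_addN : left_inverse tensor_zero tensor_opp tensor_add.
Proof.
move=> t; apply: tensor_ext => W b hb.
by rewrite lift_add // lift_zero // lift_scale // scaleN1r addNr.
Qed.

HB.instance Definition _ := GRing.isZmodule.Build tensor
  tensor_addA tensor_addC tensor_add0 tensor_addN.

Fact tensor_scaleA c d t :
  tensor_scale c (tensor_scale d t) = tensor_scale (c * d) t.
Proof. by apply: tensor_ext => W b hb; rewrite !lift_scale // scalerA. Qed.

Fact tensor_scale1 : left_id 1 tensor_scale.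
Proof. by move=> t; apply: tensor_ext => W b hb; rewrite lift_scale // scale1r. Qed.

Fact tensor_scaleDr : right_distributive tensor_scale +%R.
Proof.
move=> c t u; apply: tensor_ext => W b hb.
by rewrite lift_scale // !lift_add // !lift_scale // scalerDr.
Qed.

Fact tensor_scaleDl t : {morph tensor_scale^~ t : c d / c + d}.
Proof.
move=> c d; apply: tensor_ext => W b hb.
by rewrite lift_add // !lift_scale // scalerDl.
Qed.

HB.instance Definition _ := GRing.Zmodule_isLmodule.Build F tensor
  tensor_scaleA tensor_scale1 tensor_scaleDr tensor_scaleDl.

Lemma pure_bilinear : is_bilinear pure.
Proof.
split=> [y c x x'|x c y y']; apply: tensor_ext => W b hb;
  rewrite lift_add // lift_scale // !tensor_lift_tsum // /beval !big_seq1 /=.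
  exact: hb.1.
exact: hb.2.
Qed.

Lemma tsumE s : tsum s = \sum_(x <- s) pure x.1 x.2.
Proof.
elim: s => [|x s IH]; rewrite ?big_nil // big_cons -IH.
apply: tensor_ext => W b hb; rewrite lift_add // !tensor_lift_tsum //.
by rewrite /beval big_cons big_seq1.
Qed.

Lemma tensor_lift_linear (W : lmodType F) (b : A -> B -> W) :
  is_bilinear b -> linear (tensor_lift b).
Proof. by move=> hb c t u; rewrite lift_add // lift_scale. Qed.

Lemma tensor_lift_pure (W : lmodType F) (b : A -> B -> W) x y :
  is_bilinear b -> tensor_lift b (pure x y) = b x y.
Proof. by move=> hb; rewrite tensor_lift_tsum // /beval big_seq1. Qed.

Lemma tensor_lift_unique (W : lmodType F) (b : A -> B -> W) (h : {linear tensor -> W}) :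
  is_bilinear b -> (forall x y, h (pure x y) = b x y) -> h =1 tensor_lift b.
Proof.
move=> hb hE t; rewrite -[t]reprK -/(tsum _) tensor_lift_tsum // tsumE raddf_sum.
by apply: eq_bigr => x _; exact: hE.
Qed.

Definition tensor_map (f : A -> A) (g : B -> B) (t : tensor) : tensor :=
  \sum_(x <- repr t) pure (f x.1) (g x.2).

Lemma tensor_map_pure (f : {linear A -> A}) (g : {linear B -> B}) x y :
  tensor_map f g (pure x y) = pure (f x) (g y).
Proof.
apply: (@tensor_lift_pure _ (fun x y => pure (f x) (g y))); split=> z c u v.
  by rewrite linearP (pure_bilinear.1 (g z) c).
by rewrite linearP (pure_bilinear.2 (f z) c).
Qed.

End Construction.

Section Algebra.
Variables A B : algType F.
Local Notation T := (tensor A B).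

Definition tensor_one : T := pure 1 1.
Definition tensor_mul (t u : T) : T :=
  \sum_(x <- repr t) \sum_(y <- repr u) pure (x.1 * y.1) (x.2 * y.2).

Fact mulr_pure_bilinear (a : A) (b : B) :
  is_bilinear (fun x y => pure (x * a) (y * b) : T).
Proof.
split=> [y c u v|x c u v].
  by rewrite mulrDl -scalerAl; apply: (pure_bilinear A B).1.
by rewrite mulrDl -scalerAl; apply: (pure_bilinear A B).2.
Qed.

Fact mull_pure_bilinear (a : A) (b : B) :
  is_bilinear (fun x y => pure (a * x) (b * y) : T).
Proof.
split=> [y c u v|x c u v].
  by rewrite mulrDr -scalerAr; apply: (pure_bilinear A B).1.
by rewrite mulrDr -scalerAr; apply: (pure_bilinear A B).2.
Qed.

Lemma tensor_mul_tsum (s t : seq (A * B)) : tensor_mul (tsum s) (tsum t) =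
  \sum_(x <- s) \sum_(y <- t) pure (x.1 * y.1) (x.2 * y.2).
Proof.
rewrite /tensor_mul.
rewrite [LHS](eq_bigr (fun x =>
    \sum_(y <- t) pure (x.1 * y.1) (x.2 * y.2))) => [|x _].
  rewrite exchange_big [RHS]exchange_big; apply: eq_bigr => y _ /=.
  exact: (tensor_lift_tsum s (mulr_pure_bilinear y.1 y.2)).
exact: (tensor_lift_tsum t (mull_pure_bilinear x.1 x.2)).
Qed.

Lemma tensor_mul_pure x y x' y' :
  tensor_mul (pure x y) (pure x' y') = pure (x * x') (y * y').
Proof. by rewrite tensor_mul_tsum !big_seq1. Qed.

Fact tensor_mulDl : left_distributive tensor_mul +%R.
Proof.
move=> t u v; rewrite -[t]reprK -[u]reprK -[v]reprK -!/(tsum _).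
have -> : tsum (repr t) + tsum (repr u) = tsum (repr t ++ repr u).
  by rewrite !tsumE big_cat.
by rewrite !tensor_mul_tsum big_cat.
Qed.

Fact tensor_mulDr : right_distributive tensor_mul +%R.
Proof.
move=> v t u; rewrite -[t]reprK -[u]reprK -[v]reprK -!/(tsum _).
have -> : tsum (repr t) + tsum (repr u) = tsum (repr t ++ repr u).
  by rewrite !tsumE big_cat.
by rewrite !tensor_mul_tsum -big_split; apply: eq_bigr => x _; rewrite big_cat.
Qed.

Fact tensor_mul0 t : tensor_mul 0 t = 0.
Proof. by rewrite -[t]reprK -/(tsum _) tensor_mul_tsum big_nil. Qed.

Fact tensor_mulr0 t : tensor_mul t 0 = 0.
Proof.
by rewrite -[t]reprK -/(tsum _) tensor_mul_tsum big1 // => x _; rewrite big_nil.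
Qed.

Lemma tensor_mul_suml (s : seq (A * B)) (f : A * B -> T) t :
  tensor_mul (\sum_(x <- s) f x) t = \sum_(x <- s) tensor_mul (f x) t.
Proof.
elim: s => [|x s IH]; first by rewrite !big_nil tensor_mul0.
by rewrite !big_cons tensor_mulDl IH.
Qed.

Lemma tensor_mul_sumr (s : seq (A * B)) (f : A * B -> T) t :
  tensor_mul t (\sum_(x <- s) f x) = \sum_(x <- s) tensor_mul t (f x).
Proof.
elim: s => [|x s IH]; first by rewrite !big_nil tensor_mulr0.
by rewrite !big_cons tensor_mulDr IH.
Qed.

Fact tensor_mulA : associative tensor_mul.
Proof.
move=> t u v; rewrite -[t]reprK -[u]reprK -[v]reprK -!/(tsum _) !tsumE.
rewrite [LHS]tensor_mul_suml [X in _ = tensor_mul X _]tensor_mul_suml.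
rewrite [RHS]tensor_mul_suml; apply: eq_bigr => x _.
rewrite [X in tensor_mul _ X = _]tensor_mul_suml [LHS]tensor_mul_sumr.
rewrite [X in _ = tensor_mul X _]tensor_mul_sumr [RHS]tensor_mul_suml.
apply: eq_bigr => y _; rewrite tensor_mul_pure [RHS]tensor_mul_sumr.
rewrite [X in tensor_mul _ X = _]tensor_mul_sumr [LHS]tensor_mul_sumr.
by apply: eq_bigr => z _; rewrite !tensor_mul_pure !mulrA.
Qed.

Fact tensor_mul1l : left_id tensor_one tensor_mul.
Proof.
move=> t; rewrite -[t]reprK -/(tsum _) tensor_mul_tsum big_seq1 tsumE.
by apply: eq_bigr => x _; rewrite !mul1r.
Qed.

Fact tensor_mul1r : right_id tensor_one tensor_mul.
Proof.
move=> t; rewrite -[t]reprK -/(tsum _) tensor_mul_tsum tsumE.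
by apply: eq_bigr => x _; rewrite big_seq1 !mulr1.
Qed.

(* Only a possibly trivial ring: 1 != 0 would need linear forms on A and B. *)
HB.instance Definition _ := GRing.Zmodule_isPzRing.Build T
  tensor_mulA tensor_mul1l tensor_mul1r tensor_mulDl tensor_mulDr.

End Algebra.
End Tensor.

Section Representations.
Variable F : fieldType.

(* The matrix by which sigma acts on the column vectors of V_n. *)
Definition jordan_block (n : nat) : 'M[F]_n :=
  \matrix_(i, j) ((i == j)%:R + (i.+1 == j)%:R).

Definition sizes2 (m : nat) (i : 'I_m) : nat := 2.
Definition sizes3 (l : nat) (i : 'I_l) : nat := 3.

(* 2 for i < m and 3 for m <= i; this form makes 'I_(sizes23 i) visibly
   nonempty. *)
Definition sizes23 (m l : nat) (i : 'I_(m + l)) : nat := (m <= i)%N.+2.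

(* The direct sum of the V_(s i) for i < k. *)
Definition sumV (k : nat) (s : 'I_k -> nat) : 'M[F]_(\sum_(i < k) s i) :=
  \mxdiag_(i < k) jordan_block (s i).

Section Dual.
Variables (n : nat) (g : 'M[F]_n).

(* A linear form on 'cV_n is a row vector u : 'rV_n, acting by v |-> u *m v;
   sigma sends it to its composite with the inverse of g. *)
Definition dual_act (u : 'rV[F]_n) : 'rV[F]_n := u *m invmx g.
Definition dual_delta (u : 'rV[F]_n) : 'rV[F]_n := dual_act u - u.

(* The rows of B form a basis of V^*, and row i of dual_mx B gives the
   coordinates of sigma (row i B) in this basis. *)
Definition dual_mx (B : 'M[F]_n) : 'M[F]_n := B *m invmx g *m invmx B.

End Dual.

Section Variables23.
Variables m l : nat.

Definition dim23 : nat := \sum_(i < m + l) sizes23 i.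

(* Position of the k-th variable (k = 0, 1, 2 for X_i, Y_i, Z_i) of block i in
   the enumeration X_0, Y_0, ..., X_m, Y_m, Z_m, ... where blocks are numbered
   from 0; ixZ i is meaningful only for m <= i. *)
Definition ix (i : 'I_(m + l)) (k : nat) : 'I_dim23 :=
  tagnat.Rank i (inord k : 'I_(sizes23 i)).
Definition ixX i := ix i 0.
Definition ixY i := ix i 1.
Definition ixZ i := ix i 2.

Definition adapted_basis (B : 'M[F]_dim23) : Prop :=
  [/\ B \in unitmx,
      forall i, dual_delta (sumV (@sizes23 m l)) (row (ixX i) B) = 0,
      forall i, dual_delta (sumV (@sizes23 m l)) (row (ixY i) B) = row (ixX i) B
    & forall i : 'I_(m + l), (m <= i)%N ->
        dual_delta (sumV (@sizes23 m l)) (row (ixZ i) B) = row (ixY i) B].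

Definition blocks2 : seq 'I_(m + l) := [seq i : 'I_(m + l) <- enum 'I_(m + l) | (i < m)%N].
Definition blocks3 : seq 'I_(m + l) := [seq i : 'I_(m + l) <- enum 'I_(m + l) | (m <= i)%N].

Definition GB (p : nat) : seq {mpoly F[dim23]} :=
  [seq 'X_(ixX i) | i <- blocks2] ++
  [seq 'X_(ixY i) ^+ p | i <- blocks2] ++
  [seq 'X_(ixX i) | i <- blocks3] ++
  [seq 'X_(ixY i) * 'X_(ixY j) | i <- blocks3, j <- [seq j : 'I_(m + l) <- blocks3 | (i <= j)%N]] ++
  [seq 'X_(ixZ i) ^+ p | i <- blocks3].

(* Y_j (Y_1 ... Y_m Z_(m+1) ... Z_(m+l))^(p-1) *)
Definition top_mon (p : nat) (j : 'I_(m + l)) : 'X_{1..dim23} :=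
  (U_(ixY j) + (\sum_(i : 'I_(m + l) | (i < m)%N) U_(ixY i) +
                \sum_(i : 'I_(m + l) | (m <= i)%N) U_(ixZ i)) *+ p.-1)%MM.

Definition divides_top (p : nat) (a : 'X_{1..dim23}) : Prop :=
  exists2 j : 'I_(m + l), (m <= j)%N & (a <= top_mon p j)%MM.

End Variables23.
End Representations.

(* Main.v *)
(* The Hilbert ideal is monomial: f lies in it iff all its coefficients at
   standard monomials (those divisible by no element of GB) vanish.  Modulo the
   ideal X_i = 0, the invariant Y_i Y_j - X_i Z_j - X_j Z_i - X_i Y_j gives
   Y_i Y_j = 0, and then the norms of Y_i and Z_i give Y_i^p = Z_i^p = 0.
   Conversely, let f be an invariant of positive degree and a <> 0 a standard
   exponent.  After setting suitable variables to 0, sigma becomes the shift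
   X_v |-> X_v + X_u of a single variable, with (v, u) = (Y_i, X_i) or
   (Z_i, Y_i); its first-order term shows that a_v times the coefficient of f
   at a is 0, and 0 < a_v < p.

   For the tensor product, the projections of V_2 and V_3 type split every
   linear form of V^* into two, and the relations above hold for each half
   (where Delta^2 = 0 on (m V_2)^* kills the Y_i with i > m), so this defines a
   morphism on the coinvariants; multiplication is its inverse. *)

Require Import Defs.
From HB Require Import structures.
From mathcomp Require Import all_boot all_order all_algebra.
From mathcomp Require Import boolp.
From mathcomp Require Import ssrcomplements mpoly ring.

Set Implicit Arguments.
Unset Strict Implicit.
Unset Printing Implicit Defensive.

Import GRing.Theory.
Local Open Scope ring_scope.

(** * Linear forms and relations in the coinvariants *)

Section LinearForms.
Variables (F : fieldType) (n : nat).

Definition form (u : 'rV[F]_n) : {mpoly F[n]} := \sum_(j < n) u 0 j *: 'X_j.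

Fact form_is_linear : linear form.
Proof.
move=> c u v; rewrite /form scaler_sumr -big_split /=.
by apply: eq_bigr => j _; rewrite !mxE scalerDl scalerA.
Qed.

HB.instance Definition _ :=
  GRing.isLinear.Build F 'rV[F]_n {mpoly F[n]} *:%R form form_is_linear.

Lemma form_delta i : form (delta_mx 0 i) = 'X_i.
Proof.
rewrite /form (bigD1 i) //= mxE !eqxx scale1r big1 ?addr0 // => j ji.
by rewrite mxE eqxx (negbTE ji) scale0r.
Qed.

Lemma form_homog u : form u \is 1.-homog.
Proof.
by apply: rpred_sum => j _; apply: rpredZ; rewrite dhomogX /= mdeg1.
Qed.

Variable M : 'M[F]_n.

Lemma sigma_X i : sigma M 'X_i = form (row i M).
Proof.
rewrite /sigma comp_mpolyXU -tnth_nth tnth_mktuple /form.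
by apply: eq_bigr => j _; rewrite mxE.
Qed.

Lemma sigma_form u : sigma M (form u) = form (u *m M).
Proof.
rewrite /form raddf_sum /= (eq_bigr (fun i => u 0 i *: form (row i M))).
  rewrite -/(form _) [u *m M]mulmx_sum_row raddf_sum /=.
  by apply: eq_bigr => i _; rewrite linearZ.
by move=> i _; rewrite linearZ /= sigma_X.
Qed.

Lemma coinv_eq0 f : f \in hilbert_ideal M <-> to_coinv M f = 0.
Proof.
rewrite -[f in f \in _]subr0 Quotient.idealrBE /to_coinv.
split=> [/eqP ->|]; first exact: (rmorph0 (to_coinv M)).
by move=> ->; rewrite -(rmorph0 (to_coinv M)).
Qed.

Lemma coinv_invariant d f :
  (0 < d)%N -> f \is d.-homog -> sigma M f = f -> to_coinv M f = 0.
Proof.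
move=> d0 fd fM; apply/coinv_eq0/hilbert_idealP; exists [:: (1, f)].
split; last by rewrite big_seq1 mul1r.
by move=> x; rewrite inE => /eqP ->; split=> //; exists d.
Qed.

Lemma coinv_form_invariant u : u *m M = u -> to_coinv M (form u) = 0.
Proof.
move=> uM; apply: (@coinv_invariant 1) => //; first exact: form_homog.
by rewrite sigma_form uM.
Qed.

(** The polynomial [f] is an invariant of degree 2, and its correction terms are multiples of the
    invariant forms [x1], [x2], which vanish in the coinvariants. Arbitrary forms are allowed rather
    than variables, because the relation is also needed for the components of the variables in the
    two tensor factors. *)
Lemma coinv_form_mul x1 y1 z1 x2 y2 z2 :
  z1 *m M = z1 + y1 -> y1 *m M = y1 + x1 -> x1 *m M = x1 ->
  z2 *m M = z2 + y2 -> y2 *m M = y2 + x2 -> x2 *m M = x2 ->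
  to_coinv M (form y1 * form y2) = 0.
Proof.
move=> hz1 hy1 hx1 hz2 hy2 hx2.
have x10 := coinv_form_invariant hx1; have x20 := coinv_form_invariant hx2.
pose f := form y1 * form y2 - form x1 * form z2 - form x2 * form z1
          - form x1 * form y2.
have f0 : to_coinv M f = 0.
  apply: (@coinv_invariant 2) => //.
    by rewrite !rpredB // (dhomogM (form_homog _) (form_homog _)).
  rewrite !rmorphB !rmorphM /= !sigma_form hz1 hy1 hx1 hz2 hy2 hx2 !linearD /=.
  by rewrite /f; ring.
rewrite -[RHS]f0 !rmorphB !rmorphM /= x10 x20 !mul0r !subr0.
by [].
Qed.

End LinearForms.

(** Since y^2 = 0, only terms of degree at most 1 in y survive, and the coefficients 0, 1, ..., k of
    y add up to C(k+1, 2). *)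
Lemma prod_nilp_shift (R : comPzRingType) (z y : R) k : y * y = 0 ->
  \prod_(i < k.+1) (z + y *+ i) = z ^+ k.+1 + (z ^+ k * y) *+ 'C(k.+1, 2).
Proof.
move=> yy; elim: k => [|k IH].
  by rewrite big_ord1 mulr0n bin_small // mulr0n !addr0 expr1.
rewrite big_ord_recr IH /= mulrDl !mulrDr mulrnAl mulrnAr [X in _ + _ + (_ + X)]mulrnAr.
rewrite mulrnAl -!mulrA yy !mulr0 !mul0rn addr0 -exprSr -addrA; congr (_ + _).
by rewrite [y * z]mulrC mulrA -exprSr -mulrnDr [in RHS]binS bin1 addnC.
Qed.

(** The norm of z, that is the product of its orbit under sigma, is invariant of degree p. Modulo x
    = 0 and y^2 = 0 it becomes z^p + C(p, 2) z^(p-1) y, and p divides C(p, 2) because p is odd. *)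
Lemma coinv_form_expp (F : fieldType) n (M : 'M[F]_n) p (x y z : 'rV[F]_n) :
  prime p -> (2 < p)%N -> p \in [pchar F] ->
  z *m M = z + y -> y *m M = y + x -> x *m M = x ->
  to_coinv M (form y * form y) = 0 -> to_coinv M (form z ^+ p) = 0.
Proof.
move=> p_pr p2 pF hz hy hx yy.
have cp0 : ('C(p, 2)%:R : F) = 0.
  by apply/eqP; rewrite -(dvdn_pcharf pF) prime_dvd_bin.
(* [w k] is sigma^k z, in closed form. *)
pose w k : 'rV[F]_n := z + y *+ k + x *+ 'C(k, 2).
have wS k : w k *m M = w k.+1.
  rewrite /w !mulmxDl -!scaler_nat -!scalemxAl hz hy hx binS bin1.
  by apply/rowP => j; rewrite !mxE natrD -natr1; ring.
(* The orbit closes up after p steps: both p and C(p, 2) vanish in F. *)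
have wp : w p = w 0%N.
  by rewrite /w [in RHS]bin_small // !mulr0n -!scaler_nat cp0 (pcharf0 pF) !scale0r.
case: p p_pr p2 pF cp0 wp => [//|q] p_pr p2 pF cp0 wp.
pose N := \prod_(k < q.+1) form (w k).
have N0 : to_coinv M N = 0.
  apply: (@coinv_invariant _ _ _ q.+1) => //.
    rewrite -[X in X.-homog]muln1 -[X in (X * _)%N]card_ord -sum_nat_const.
    elim/big_rec2: N => [|k d f _ fd]; first exact: dhomog1.
    by apply: dhomogM => //; apply: form_homog.
  (* sigma permutes the factors cyclically: the last one is sent to [w p], which is [w 0]. *)
  rewrite rmorph_prod /= /N big_ord_recr big_ord_recl /= sigma_form wS wp mulrC.
  by congr (_ * _); apply: eq_bigr => k _; rewrite sigma_form wS.
have yy' : to_coinv M (form y) * to_coinv M (form y) = 0 by rewrite -rmorphM.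
have := prod_nilp_shift (to_coinv M (form z)) q yy'.
rewrite -scaler_nat cp0 scale0r addr0 rmorphXn => <-.
rewrite -N0 rmorph_prod; apply: eq_bigr => k _.
have x0 := coinv_form_invariant hx.
rewrite /w !raddfD !raddfMn /=. by rewrite x0 mul0rn addr0.
Qed.

(** * First-order term of the shift of one variable *)

Lemma exprD_taylor (R : comPzRingType) (a x : R) k :
  exists q, (a + x) ^+ k = a ^+ k + x * (a ^+ k.-1 *+ k + x * q).
Proof.
elim: k => [|k [q IH]]; first by exists 0; rewrite !expr0 mulr0n mulr0 addr0 mulr0 addr0.
exists (a ^+ k.-1 *+ k + x * q + a * q); rewrite exprS IH exprS /=.
have -> : a ^+ k *+ k.+1 = a ^+ k + a * (a ^+ k.-1 *+ k).
  by case: (k) => [|j]; rewrite ?mulr0n ?mulr0 ?addr0 // mulrnAr -exprS mulrS.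
ring.
Qed.

Section Taylor.
Variables (F : fieldType) (n : nat) (s : 'I_n -> F).

(** It is applied with scalars 0 and 1, so that it sets some of the variables to 0 and keeps the
    others. *)
Definition rescale := comp_mpoly [tuple s i *: 'X_i : {mpoly F[n]} | i < n].
HB.instance Definition _ := GRing.LRMorphism.copy rescale
  (comp_mpoly [tuple s i *: 'X_i : {mpoly F[n]} | i < n]).

Lemma rescale_X i : rescale 'X_i = s i *: 'X_i.
Proof. by rewrite /rescale comp_mpolyXU -tnth_nth tnth_mktuple. Qed.

Lemma rmorph_mpolyX (f : {rmorphism {mpoly F[n]} -> {mpoly F[n]}}) b :
  f 'X_[b] = \prod_i f 'X_i ^+ b i.
Proof.
by rewrite mpolyXE_id rmorph_prod; apply: eq_bigr => i _; rewrite rmorphXn.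
Qed.

Lemma rescale_mpolyX b : rescale 'X_[b] = (\prod_i s i ^+ b i) *: 'X_[b].
Proof.
rewrite rmorph_mpolyX mpolyXE_id -scaler_prod.
by apply: eq_bigr => i _; rewrite /= rescale_X exprZn.
Qed.

Variables (M : 'M[F]_n) (u v : 'I_n).
Hypothesis (sM : forall i, rescale (sigma M 'X_i) =
  s i *: 'X_i + (i == v)%:R *: 'X_u).

(* To first order in X_u, the rescaled sigma is the shift X_v |-> X_v + X_u. *)
Lemma mcoeff_shift (a : 'X_{1..n}) f : a u = 0%N -> (0 < a v)%N ->
    (forall i, (a - U_(v))%MM i != 0%N -> s i = 1) ->
  (rescale (sigma M f) - rescale f)@_(U_(u) + (a - U_(v))) = f@_a *+ a v.
Proof.
move=> au av sa; rewrite [f]mpolyE (raddf_sum (sigma M)) !(raddf_sum rescale) -sumrB !raddf_sum /= -sumrMnl.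
apply: eq_bigr => b _; rewrite [sigma _ _]linearZ ![rescale _]linearZ /= -scalerBr !mcoeffZ -mulrnAr.
congr (_ * _); rewrite mcoeffX.
(* [W] collects the variables other than X_v; both rescaled monomials have it as a common factor. *)
pose W := \prod_(i < n | i != v) (s i *: 'X_i) ^+ b i : {mpoly F[n]}.
have -> : rescale (sigma M 'X_[b]) = (s v *: 'X_v + 'X_u) ^+ b v * W.
  rewrite [LHS](rmorph_mpolyX (rescale \o sigma M)) (bigD1 v) //= sM eqxx scale1r.
  by congr (_ * _); apply: eq_bigr => i /negbTE iv; rewrite sM iv scale0r addr0.
have -> : rescale 'X_[b] = (s v *: 'X_v) ^+ b v * W.
  rewrite rmorph_mpolyX (bigD1 v) //= rescale_X.
  by congr (_ * _); apply: eq_bigr => i _; rewrite /= rescale_X.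
have [q ->] := exprD_taylor (s v *: 'X_v : {mpoly F[n]}) 'X_u (b v).
rewrite -mulrBl addrAC subrr add0r mulrDr mulrDl mulrA -expr2 raddfD /=.
(* The remainder is divisible by X_u^2, whereas the exponent examined has value 1 at u, because
   [a u = 0]. *)
have -> : ('X_u ^+ 2 * q * W : {mpoly F[n]})@_(U_(u) + (a - U_(v))) = 0.
  apply: memN_msupp_eq0; rewrite -mulrA expr2 -mulrA mulrC.
  rewrite (perm_mem (msuppMX _ _)); apply/negP => /mapP [c].
  rewrite mulrC (perm_mem (msuppMX _ _)) => /mapP [d _ ->] /addmI.
  by move=> /mnmP /(_ u); rewrite mnmBE au sub0n mnmDE mnm1E eqxx.
rewrite addr0 -mulrA mulrC mcoeffMX mulrnAl mcoeffMn.
have [b0|bv] := eqVneq (b v) 0%N.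
  by rewrite b0 mulr0n; case: eqP => [ba|]; [rewrite -ba b0 in av | rewrite mul0rn].
have ub : (U_(v) <= b)%MM by rewrite lep1mP.
have ua : (U_(v) <= a)%MM by rewrite lep1mP -lt0n.
have -> : (s v *: 'X_v) ^+ (b v).-1 * W = rescale 'X_[b - U_(v)].
  rewrite rmorph_mpolyX (bigD1 v) //= rescale_X mnmBE mnm1E eqxx subn1.
  congr (_ * _); apply: eq_bigr => i iv.
  by rewrite rescale_X mnmBE mnm1E [v == i]eq_sym (negbTE iv) subn0.
rewrite rescale_mpolyX mcoeffZ mcoeffX.
have -> : ((b - U_(v))%MM == (a - U_(v))%MM) = (b == a).
  by rewrite -(eqm_add2r U_(v)) !submK.
have [->|] := eqVneq b a; last by rewrite mulr0 !mul0rn.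
(* By [sa], rescaling fixes the monomial of exponent a - U_v. *)
rewrite big1 ?mulr1 // => i _.
by have [->|/sa ->] := eqVneq ((a - U_(v))%MM i) 0%N; rewrite ?expr0 ?expr1n.
Qed.

(** Invariance makes the difference in [mcoeff_shift] zero, so a_v times the coefficient vanishes,
    and a_v is invertible in F. *)
Lemma invariant_mcoeff_eq0 (a : 'X_{1..n}) f : sigma M f = f ->
    a u = 0%N -> (a v)%:R != 0 :> F ->
    (forall i, (a - U_(v))%MM i != 0%N -> s i = 1) ->
  f@_a = 0.
Proof.
move=> fM au av sa; have av0 : (0 < a v)%N.
  by case: (a v) av; rewrite ?eqxx.
have := mcoeff_shift f au av0 sa; rewrite fM subrr mcoeff0 -mulr_natr.
by move/esym/eqP; rewrite mulf_eq0 (negbTE av) orbF => /eqP.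
Qed.
End Taylor.

(** * Indices of the variables and standard monomials *)

Section Indices.
Variables m l : nat.
Implicit Types i j : 'I_(m + l).

Lemma ix_eq i j k k' : (k < sizes23 i)%N -> (k' < sizes23 j)%N ->
  (ix i k == ix j k') = (i == j) && (k == k').
Proof. by move=> ki kj; rewrite /ix -val_eqE tagnat.eq_Rank !inordK. Qed.

Lemma ix_cover (c : 'I_(dim23 m l)) :
  exists i k, (k < sizes23 i)%N /\ c = ix i k.
Proof.
exists (tagnat.sig1 c), (tagnat.sig2 c); split; first exact: ltn_ord.
by rewrite /ix inord_val tagnat.sig2K.
Qed.

Lemma ix_case (P : 'I_(dim23 m l) -> Prop) :
  (forall i, P (ixX i)) -> (forall i, P (ixY i)) ->
  (forall i, (m <= i)%N -> P (ixZ i)) -> forall c, P c.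
Proof.
move=> hX hY hZ c; have [i [[|[|[|k]]] [ki ->]]] := ix_cover c.
- exact: hX.
- exact: hY.
- by apply: hZ; move: ki; rewrite /sizes23; case: (m <= i)%N.
- by move: ki; rewrite /sizes23; case: (m <= i)%N.
Qed.

Lemma ixYY i j : (ixY i == ixY j) = (i == j).
Proof. by rewrite ix_eq // andbT. Qed.
Lemma ixZZ i j : (m <= i)%N -> (m <= j)%N -> (ixZ i == ixZ j) = (i == j).
Proof. by move=> mi mj; rewrite ix_eq ?andbT // /sizes23 (mi, mj). Qed.
Lemma ixXY i j : (ixX i == ixY j) = false.
Proof. by rewrite ix_eq // andbF. Qed.
Lemma ixXZ i j : (m <= j)%N -> (ixX i == ixZ j) = false.
Proof. by move=> mj; rewrite ix_eq ?andbF // /sizes23 mj. Qed.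
Lemma ixYZ i j : (m <= j)%N -> (ixY i == ixZ j) = false.
Proof. by move=> mj; rewrite ix_eq ?andbF // /sizes23 mj. Qed.
End Indices.

Lemma lemMn n (c : 'I_n) k (a : 'X_{1..n}) : (U_(c) *+ k <= a)%MM = (k <= a c)%N.
Proof.
apply/mnm_lepP/idP => [/(_ c)|ka d]; first by rewrite mulmnE mnm1E eqxx mul1n.
by rewrite mulmnE mnm1E; case: eqP => [<-|]; rewrite ?mul1n.
Qed.

Lemma le_ltm n (g h : 'X_{1..n}) : (h <= g)%MM -> h != g ->
  exists2 c, (0 < g c)%N & (h <= g - U_(c))%MM.
Proof.
move=> /mnm_lepP hg; apply: contraNP => hn; apply/eqP/mnmP => c.
apply/eqP; rewrite eqn_leq hg leqNgt /=; apply/negP => lt_c; apply: hn.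
exists c; first exact: leq_ltn_trans lt_c.
apply/mnm_lepP => d; rewrite mnmBE mnm1E.
by case: eqP => [<-|_]; rewrite ?subn0 ?subn1 // -ltnS prednK // (leq_ltn_trans _ lt_c).
Qed.

Section Standard.
Variables m l p : nat.
Local Notation N := (dim23 m l).
Implicit Types (i j : 'I_(m + l)) (a b : 'X_{1..N}).

Definition GBmon : seq 'X_{1..N} :=
  [seq U_(ixX i)%MM | i <- blocks2 m l] ++
  [seq (U_(ixY i) *+ p)%MM | i <- blocks2 m l] ++
  [seq U_(ixX i)%MM | i <- blocks3 m l] ++
  [seq (U_(ixY i) + U_(ixY j))%MM | i <- blocks3 m l,
     j <- [seq j : 'I_(m + l) <- blocks3 m l | (i <= j)%N]] ++
  [seq (U_(ixZ i) *+ p)%MM | i <- blocks3 m l].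

Lemma GB_GBmon (F : fieldType) : GB F m l p = [seq 'X_[g] | g <- GBmon].
Proof.
rewrite /GB /GBmon !map_cat -!map_comp map_allpairs.
congr (_ ++ _); congr (_ ++ _); last congr (_ ++ _); last congr (_ ++ _).
- by apply: eq_map => i /=; rewrite mpolyXn.
- by apply: eq_allpairs => i j; rewrite mpolyXD.
- by apply: eq_map => i /=; rewrite mpolyXn.
Qed.

Lemma mem_blocks2 i : (i \in blocks2 m l) = (i < m)%N.
Proof. by rewrite mem_filter mem_enum andbT. Qed.
Lemma mem_blocks3 i : (i \in blocks3 m l) = (m <= i)%N.
Proof. by rewrite mem_filter mem_enum andbT. Qed.

(** The generators up to the symmetry Y_i Y_j = Y_j Y_i: the condition i <= j disappears and the two
    families of X_i are merged. *)
Variant GBmon_spec : 'X_{1..N} -> Prop :=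
  | GBmonX i : GBmon_spec U_(ixX i)
  | GBmonY i of (i < m)%N : GBmon_spec (U_(ixY i) *+ p)
  | GBmonZ i of (m <= i)%N : GBmon_spec (U_(ixZ i) *+ p)
  | GBmonYY i j of (m <= i)%N & (m <= j)%N : GBmon_spec (U_(ixY i) + U_(ixY j)).

Lemma GBmonP g : reflect (GBmon_spec g) (g \in GBmon).
Proof.
apply: (iffP idP); rewrite !mem_cat.
  case/or4P => [/mapP[i _ ->]|/mapP[i im ->]|/mapP[i _ ->]|/orP[]].
  - exact: GBmonX.
  - by apply: GBmonY; rewrite -mem_blocks2.
  - exact: GBmonX.
  - case/allpairsPdep => i [j []]; rewrite mem_blocks3 mem_filter => im.
    by case/andP=> _; rewrite mem_blocks3 => jm ->; apply: GBmonYY.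
  - by case/mapP => i im ->; apply: GBmonZ; rewrite -mem_blocks3.
case=> [i|i im|i im|i j im jm]; apply/or4P.
- by case: (ltnP i m) => im; [apply: Or41 | apply: Or43]; apply/mapP; exists i;
    rewrite ?mem_blocks2 ?mem_blocks3.
- by apply: Or42; apply/mapP; exists i; rewrite ?mem_blocks2.
- by apply: Or44; apply/orP; right; apply/mapP; exists i; rewrite ?mem_blocks3.
- apply: Or44; apply/orP; left; apply/allpairsPdep.
  have [ij|/ltnW ji] := leqP i j.
    by exists i, j; rewrite mem_blocks3 mem_filter mem_blocks3 im jm ij.
  by exists j, i; rewrite mem_blocks3 mem_filter mem_blocks3 im jm ji addmC.
Qed.

Definition std a := all (fun g => ~~ (g <= a)%MM) GBmon.

Lemma stdP a : reflect
  [/\ forall i, a (ixX i) = 0%N, forall i, (i < m)%N -> (a (ixY i) < p)%N,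
      forall i, (m <= i)%N -> (a (ixZ i) < p)%N
    & forall i j, (m <= i)%N -> (m <= j)%N -> ~~ (U_(ixY i) + U_(ixY j) <= a)%MM]
  (std a).
Proof.
apply: (iffP allP) => [h|[hX hY hZ hYY] _ /GBmonP [i|i im|i im|i j im jm]].
  split=> [i|i im|i im|i j im jm].
  - have := h _ (introT (GBmonP _) (GBmonX i)).
    by rewrite lep1mP negbK => /eqP.
  - by have := h _ (introT (GBmonP _) (GBmonY im)); rewrite lemMn ltnNge.
  - by have := h _ (introT (GBmonP _) (GBmonZ im)); rewrite lemMn ltnNge.
  - by have := h _ (introT (GBmonP _) (GBmonYY im jm)).
- by rewrite lep1mP hX.
- by rewrite lemMn -ltnNge hY.
- by rewrite lemMn -ltnNge hZ.
- exact: hYY.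
Qed.

Lemma std_le a b : (a <= b)%MM -> std b -> std a.
Proof.
by move=> ab /allP h; apply/allP => g /h; apply: contra => /lepm_trans; apply.
Qed.

(** Otherwise Y_i Y_j would divide a; the case i = j is included, which bounds the exponent of Y_i
    by 1. *)
Lemma std_Y a i j : std a -> (m <= i)%N -> (m <= j)%N -> (0 < a (ixY i))%N ->
  (a - U_(ixY i))%MM (ixY j) = 0%N.
Proof.
case/stdP => _ _ _ hYY im jm ai; apply/eqP; rewrite -leqn0 leqNgt.
apply: contra (hYY i j im jm) => aj; have ua : (U_(ixY i) <= a)%MM by rewrite lep1mP -lt0n.
rewrite -(submK ua) addmC; apply/mnm_lepP => c; rewrite !mnmDE leq_add2r.
by move: c; apply/mnm_lepP; rewrite lep1mP -lt0n.
Qed.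

Lemma std_Yle1 a i : std a -> (m <= i)%N -> (a (ixY i) <= 1)%N.
Proof.
move=> sa im; rewrite leqNgt; apply/negP => ai; have := std_Y sa im im (ltnW ai).
by move/eqP; rewrite mnmBE mnm1E eqxx subn_eq0 leqNgt ai.
Qed.

Hypothesis p1 : (1 < p)%N.

Lemma std_Mn (c : 'I_N) k : (k < p)%N ->
  (forall i, c = ixX i -> k = 0%N) ->
  (forall i, (m <= i)%N -> c = ixY i -> (k <= 1)%N) -> std (U_(c) *+ k).
Proof.
move=> kp hX hY.
have e d : (U_(c) *+ k)%MM d = if c == d then k else 0%N.
  by rewrite mulmnE mnm1E; case: eqP; rewrite ?mul1n.
apply/stdP; split=> [i|i im|i im|i j im jm].
- by rewrite e; case: eqP => // /hX.
- by rewrite e; case: eqP => // _; apply: ltnW.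
- by rewrite e; case: eqP => // _; apply: ltnW.
- apply/negP => /mnm_lepP h.
  have ci : c = ixY i.
    by have := h (ixY i); rewrite mnmDE !mnm1E eqxx e; case: (c =P ixY i).
  have cj : c = ixY j.
    by have := h (ixY j); rewrite mnmDE !mnm1E eqxx addn1 e; case: (c =P ixY j).
  have := h c; rewrite mnmDE !mnm1E e -ci -cj eqxx => /leq_trans /(_ (hY _ im ci)).
  by [].
Qed.

(** A proper divisor of a generator g divides g / X_c for some variable X_c of g. All these
    quotients are standard, hence divisible by no generator. *)
Lemma GBmon_antichain g h : g \in GBmon -> h \in GBmon -> (h <= g)%MM -> h = g.
Proof.
move=> gG hG hg; apply/eqP/negPn/negP => /(le_ltm hg) [c gc hgc].
suff /allP/(_ _ hG) : std (g - U_(c)) by rewrite hgc.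
(* A pure power is divisible by one variable only, so the quotient is the next lower power of it. *)
have pow d k : (0 < k)%N -> (0 < (U_(d) *+ k)%MM c)%N ->
    (U_(d) *+ k - U_(c) = U_(d) *+ k.-1)%MM.
  case: k => // k _; rewrite mulmnE mnm1E muln_gt0; case: eqP => // <- _.
  by rewrite mulmSr addmK.
case/GBmonP: gG gc {hg hgc} => [i|i im|i im|i j im jm].
- rewrite -[U_(ixX i)%MM]mulm1n => gc; rewrite (pow (ixX i) 1%N) //.
  by apply: std_Mn => //; apply: ltnW.
- move=> gc; rewrite pow ?(ltnW p1) //; apply: std_Mn.
  + by rewrite ltn_predL ltnW.
  + by move=> j /eqP; rewrite eq_sym ixXY.
  + by move=> j jm /eqP; rewrite ixYY => /eqP ij; rewrite ij ltnNge jm in im.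
- move=> gc; rewrite pow ?(ltnW p1) //; apply: std_Mn.
  + by rewrite ltn_predL ltnW.
  + by move=> j /eqP; rewrite eq_sym ixXZ.
  + by move=> j jm /eqP; rewrite eq_sym ixYZ.
- have sY k : std U_(ixY k).
    rewrite -[U_(_)%MM]mulm1n; apply: std_Mn => // i' /eqP.
    by rewrite eq_sym ixXY.
  rewrite mnmDE !mnm1E; have [<- _|_] := eqVneq (ixY i) c.
    by rewrite addmC addmK.
  by have [<- _|//] := eqVneq (ixY j) c; rewrite addmK.
Qed.

End Standard.

(** * The Hilbert ideal *)

Section ByKind.
Variables (m l : nat) (R : Type) (fX fY fZ : 'I_(m + l) -> R).

Definition by_kind (c : 'I_(dim23 m l)) : R :=
  let i := tagnat.sig1 c in
  match val (tagnat.sig2 c) with 0 => fX i | 1 => fY i | _ => fZ i end.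

Lemma by_kind_ix i k : (k < sizes23 i)%N ->
  by_kind (ix i k) = match k with 0 => fX i | 1 => fY i | _ => fZ i end.
Proof. by move=> ki; rewrite /by_kind /ix tagnat.Rank2K /= inordK // tagnat.Rank1K. Qed.

Lemma by_kindX (i : 'I_(m + l)) : by_kind (ixX i) = fX i. Proof. exact: by_kind_ix. Qed.
Lemma by_kindY (i : 'I_(m + l)) : by_kind (ixY i) = fY i. Proof. exact: by_kind_ix. Qed.
Lemma by_kindZ (i : 'I_(m + l)) : (m <= i)%N -> by_kind (ixZ i) = fZ i.
Proof. by move=> im; rewrite by_kind_ix // /sizes23 im. Qed.

End ByKind.

Lemma row_dual_mx (F : fieldType) n (g B : 'M[F]_n) i w :
  B \in unitmx -> dual_delta g (row i B) = w ->
  row i (dual_mx g B) = delta_mx 0 i + w *m invmx B.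
Proof.
move=> uB <-; rewrite /dual_delta /dual_act /dual_mx mulmxBl !row_mul.
have -> : row i B *m invmx B = delta_mx 0 i by rewrite -row_mul mulmxV // row1.
by rewrite addrC subrK.
Qed.

Section AdaptedMatrix.
Variables (F : fieldType) (m l : nat).
Implicit Types i j : 'I_(m + l).

(** The action in coordinates, for an adapted basis. The Hilbert ideal is studied for a matrix of
    this shape, and [adapted_basis_mx] makes the link with the representation. *)
Definition adapted_mx (M : 'M[F]_(dim23 m l)) : Prop :=
  [/\ forall i, row (ixX i) M = delta_mx 0 (ixX i),
      forall i, row (ixY i) M = delta_mx 0 (ixY i) + delta_mx 0 (ixX i)
    & forall i, (m <= i)%N -> row (ixZ i) M = delta_mx 0 (ixZ i) + delta_mx 0 (ixY i)].

Lemma adapted_basis_mx B : adapted_basis B -> adapted_mx (dual_mx (sumV F (@sizes23 m l)) B).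
Proof.
have dB c (uB : B \in unitmx) : row c B *m invmx B = delta_mx 0 c.
  by rewrite -row_mul mulmxV // row1.
case=> uB hX hY hZ; split=> [i|i|i im].
- by rewrite (row_dual_mx uB (hX i)) mul0mx addr0.
- by rewrite (row_dual_mx uB (hY i)) dB.
- by rewrite (row_dual_mx uB (hZ i im)) dB.
Qed.

Variables (M : 'M[F]_(dim23 m l)) (p : nat).
Hypotheses (p_pr : prime p) (p2 : (2 < p)%N) (pF : p \in [pchar F]) (MA : adapted_mx M).

Local Notation d c := (delta_mx 0 c : 'rV[F]_(dim23 m l)).

Let MX i : d (ixX i) *m M = d (ixX i).
Proof. by rewrite -rowE; case: MA. Qed.
Let MY i : d (ixY i) *m M = d (ixY i) + d (ixX i).
Proof. by rewrite -rowE; case: MA. Qed.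
Let MZ i : (m <= i)%N ->
  d (ixZ i) *m M = d (ixZ i) + d (ixY i).
Proof. by move=> im; rewrite -rowE; case: MA => _ _; apply. Qed.
Let sX i : sigma M 'X_(ixX i) = 'X_(ixX i).
Proof. by rewrite -form_delta sigma_form MX. Qed.
Let sY i : sigma M 'X_(ixY i) = 'X_(ixY i) + 'X_(ixX i).
Proof. by rewrite -!form_delta sigma_form MY raddfD. Qed.
Let sZ i : (m <= i)%N -> sigma M 'X_(ixZ i) = 'X_(ixZ i) + 'X_(ixY i).
Proof. by move=> im; rewrite -!form_delta sigma_form MZ // raddfD. Qed.

Lemma coinv_GBmon g : g \in GBmon m l p -> to_coinv M 'X_[g] = 0.
Proof.
case/GBmonP => [i|i im|i im|i j im jm].
- by rewrite -form_delta; apply: coinv_form_invariant.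
- rewrite -mpolyXn -form_delta.
  (* In a block of type V_2 the chain z, y, x is Y_i, X_i, 0. *)
  apply: (coinv_form_expp p_pr p2 pF (MY i) (x := 0)).
  + by rewrite addr0.
  + by rewrite mul0mx.
  + by rewrite rmorphM /= (coinv_form_invariant (MX i)) mul0r.
- rewrite -mpolyXn -form_delta.
  apply: (coinv_form_expp p_pr p2 pF (MZ im) (MY i) (MX i)).
  exact: coinv_form_mul (MZ im) (MY i) (MX i) (MZ im) (MY i) (MX i).
- rewrite mpolyXD -!form_delta.
  exact: coinv_form_mul (MZ im) (MY i) (MX i) (MZ jm) (MY j) (MX j).
Qed.

Lemma coinv_nonstd a : ~~ std p a -> to_coinv M 'X_[a] = 0.
Proof.
rewrite /std -has_predC => /hasP [g gG] /= /negPn ga.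
by rewrite -(submK ga) mpolyXD rmorphM /= (coinv_GBmon gG) mulr0.
Qed.

(** The cases are ordered so that the substitution keeps every variable left in a after one shifted
    variable is removed. The shift of Y_i needs that no Y_j with j >= m is left, the shift of Z_i
    that a contains no Y_j at all. In the remaining case a = 0, and a form of positive degree has no
    constant term. *)
Lemma invariant_std_eq0 d f a : (0 < d)%N -> f \is d.-homog -> sigma M f = f ->
  std p a -> f@_a = 0.
Proof.
move=> d0 fd fM sa; have [aX aY aZ _] := stdP _ _ sa.
have pN0 k : (0 < k)%N -> (k < p)%N -> k%:R != 0 :> F.
  by move=> k0 kp; rewrite -(dvdn_pcharf pF) gtnNdvd.
(* Setting to 0 the X_j with j <> i and the Y_j with j >= m removes every increment sigma - 1 of a
   variable except the increment X_i of Y_i. *)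
have caseY i : (0 < a (ixY i))%N -> (a (ixY i) < p)%N ->
    (forall j, (m <= j)%N -> (a - U_(ixY i))%MM (ixY j) = 0%N) -> f@_a = 0.
  move=> ai aip h.
  apply: (@invariant_mcoeff_eq0 _ _ (by_kind (fun j => (j == i)%:R)
    (fun j => (j < m)%N%:R) (fun=> 1)) M (ixX i) (ixY i)) => //.
  - apply: ix_case => [j|j|j jm].
    + by rewrite sX rescale_X ixXY scale0r addr0.
    + rewrite sY [rescale _ _]raddfD /= !rescale_X by_kindX ixYY.
      by case: (eqVneq j i) => [->|_]; rewrite ?scale0r.
    + rewrite sZ // [rescale _ _]raddfD /= !rescale_X by_kindY.
      by rewrite ltnNge jm scale0r [_ == ixY i]eq_sym ixYZ // scale0r.
  - exact (pN0 _ ai aip).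
  - apply: ix_case => [j|j|j jm].
    + by rewrite mnmBE aX.
    + by rewrite by_kindY; case: (ltnP j m) => // /h ->.
    + by rewrite by_kindZ.
case: (pickP (fun i : 'I_(m + l) => (m <= i)%N && (0 < a (ixY i))%N)).
  move=> i /andP[im ai]; apply: (caseY i) => // [|j jm].
    by apply: leq_ltn_trans p2; apply: leq_trans (std_Yle1 sa im) _.
  exact: (std_Y sa im jm ai).
move=> noY3; have a3 j : (m <= j)%N -> a (ixY j) = 0%N.
  by move=> jm; apply/eqP; have := noY3 j; rewrite /= jm lt0n /= => /negbFE.
case: (pickP (fun i : 'I_(m + l) => 0 < a (ixY i))%N).
  move=> i ai; have im : (i < m)%N.
    by rewrite ltnNge; apply/negP => /a3 a0; rewrite a0 in ai.
  by apply: (caseY i) => // [|j jm]; rewrite ?aY // mnmBE a3.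
move=> noY; have a2 j : a (ixY j) = 0%N.
  by apply/eqP; have := noY j; rewrite /= lt0n => /negbFE.
case: (pickP (fun i : 'I_(m + l) => (m <= i)%N && (0 < a (ixZ i))%N)).
  move=> i /andP[im ai].
  (* Here all X_j and all Y_j with j <> i are set to 0, so that only Z_i is shifted, by Y_i. *)
  apply: (@invariant_mcoeff_eq0 _ _ (by_kind (fun=> 0)
    (fun j => (j == i)%:R) (fun=> 1)) M (ixY i) (ixZ i)) => //.
  - apply: ix_case => [j|j|j jm].
    + by rewrite sX rescale_X ixXZ // scale0r addr0.
    + rewrite sY [rescale _ _]raddfD /= !rescale_X by_kindX ixYZ //.
      by rewrite !scale0r.
    + rewrite sZ // [rescale _ _]raddfD /= !rescale_X by_kindY ixZZ //.
      by case: (eqVneq j i) => [->|_]; rewrite ?scale0r.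
  - exact: pN0 ai (aZ _ im).
  - apply: ix_case => [j|j|j jm].
    + by rewrite mnmBE aX.
    + by rewrite mnmBE a2.
    + by rewrite by_kindZ.
move=> noZ; have -> : a = 0%MM.
  apply/mnmP; apply: ix_case => [j|j|j jm]; rewrite mnm0E ?aX ?a2 //.
  by apply/eqP; have := noZ j; rewrite /= jm lt0n /= => /negbFE.
by apply: (dhomog_nemf_coeff fd); rewrite /= mdeg0 eq_sym -lt0n.
Qed.

(** If f is a combination of invariants, its coefficient at a standard a only involves coefficients
    of these invariants at divisors of a, which are again standard. Conversely, nonstandard
    monomials vanish in the coinvariants. *)
Lemma hilbertP f :
  f \in hilbert_ideal M <-> (forall a, std p a -> f@_a = 0).
Proof.
split=> [/hilbert_idealP [s [sM ->]] a sa|f0].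
  rewrite raddf_sum /= big_seq big1 // => x /sM [xM [d d0 xd]].
  rewrite mcoeffM big1 // => k /eqP ak.
  rewrite (invariant_std_eq0 d0 xd xM) ?mulr0 //.
  by apply: std_le sa; have := lem_addl k.1 k.2; rewrite -ak.
apply/coinv_eq0; rewrite [f]mpolyE raddf_sum /= big1 // => a _.
rewrite linearZ /=; have [/f0 ->|/coinv_nonstd ->] := boolP (std p a).
  by rewrite scale0r.
by rewrite scaler0.
Qed.

End AdaptedMatrix.

(** * Monomial Groebner bases *)

Lemma ideal_gen_sub (R : comNzRingType) (S T : R -> Prop) h :
  (forall x, S x -> exists q y, T y /\ x = q * y) -> ideal_gen S h -> ideal_gen T h.
Proof.
move=> ST [s [sS ->]] {h}; elim: s sS => [|[c x] s IH] sS.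
  by exists [::]; rewrite !big_nil.
have [|t [tT e]] := IH; first by move=> z zs; apply: sS; rewrite inE zs orbT.
have [q [y [Ty /= xqy]]] := ST x (sS (c, x) (mem_head _ _)).
exists ((c * q, y) :: t); split; last by rewrite !big_cons e /= xqy mulrA.
by move=> z; rewrite inE => /predU1P [->|/tT].
Qed.

Section MonomialIdeals.
Variables (F : fieldType) (n : nat).
Implicit Types (a g : 'X_{1..n}) (f : {mpoly F[n]}).

Lemma lead_monX g : lead_mon ('X_[g] : {mpoly F[n]}) = g.
Proof.
rewrite /lead_mon msuppX unlock /=; case: ifP => //; rewrite /grevlex_lt mdeg0.
by rewrite ltn0 /= mdeg_eq0 => /andP[/eqP ->].
Qed.

(** The initial value [0%MM] of the maximum could only replace a monomial of degree 0, which is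
    [0%MM] itself. *)
Lemma lead_mon_supp f : f != 0 -> lead_mon f \in msupp f.
Proof.
rewrite -msupp_eq0 /lead_mon; elim: (msupp f) => // a s IH _; rewrite big_cons inE.
case: ifP; last by rewrite eqxx.
case: s IH => [_|b s IH _]; last by rewrite IH // orbT.
rewrite big_nil /grevlex_lt mdeg0 ltn0 /= mdeg_eq0.
by case: (a =P 0%MM) => // ->; rewrite eqxx.
Qed.

(** The ideal is generated by monomials: a nonzero coefficient at a must come from some multiple of
    a single generator. *)
Lemma lead_ideal_supp (S : {mpoly F[n]} -> Prop) (h : {mpoly F[n]}) a : lead_ideal S h ->
  a \in msupp h -> exists2 f, S f & (lead_mon f <= a)%MM.
Proof.
case=> s [sS ->]; rewrite mcoeff_msupp raddf_sum /=.
elim: s sS => [|x s IH] sS; first by rewrite big_nil eqxx.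
rewrite big_cons; have [->|x0 _] := eqVneq (x.1 * x.2)@_a 0.
  by rewrite add0r; apply: IH => z zs; apply: sS; rewrite inE zs orbT.
have [f [Sf _ xf]] := sS x (mem_head _ _); exists f => //.
move: x0; rewrite -mcoeff_msupp xf (perm_mem (msuppMX _ _)).
by case/mapP => b _ ->; apply: lem_addr.
Qed.

Variables (I : {pred {mpoly F[n]}}) (L : seq 'X_{1..n}).
Hypothesis IL : forall f,
  f \in I <-> (forall a, all (fun g => ~~ (g <= a)%MM) L -> f@_a = 0).
Hypothesis antichain : {in L &, forall g h, (h <= g)%MM -> h = g}.

(** By [IL], every monomial in the support of an element of I is divisible by a member of L; this
    applies to the leading one. The elements of the basis being monomials, reducedness amounts to
    [antichain]. *)
Lemma reduced_groebner_monomials :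
  reduced_groebner_basis I [seq 'X_[g] | g <- L].
Proof.
have GI : {subset [seq 'X_[g] | g <- L] <= I}.
  move=> _ /mapP [g gL ->]; apply/IL => a /allP/(_ g gL).
  by rewrite mcoeffX; case: eqP => // ->; rewrite lepm_refl.
split; first split=> // h.
- split; last first.
    apply: ideal_gen_sub => _ [f [fG f0 ->]]; exists 1, 'X_[lead_mon f].
    by rewrite mul1r; split=> //; exists f; split=> //; apply: GI.
  apply: ideal_gen_sub => _ [f [fI f0 ->]].
  have [/((IL f).1 fI)/eqP fl|] := boolP (all (fun g => ~~ (g <= lead_mon f)%MM) L).
    by have := lead_mon_supp f0; rewrite mcoeff_msupp fl.
  rewrite -has_predC => /hasP [g gL] /= /negPn gf.
  exists 'X_[lead_mon f - g], 'X_[g]; rewrite -mpolyXD submK //; split=> //.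
  exists 'X_[g]; rewrite lead_monX; split=> //; first exact: map_f.
  by rewrite -msupp_eq0 msuppX.
- move=> _ /mapP [g gL ->]; rewrite lead_monX mcoeffX eqxx; split=> // a.
  rewrite msuppX inE => /eqP -> /lead_ideal_supp gl.
  have [|_ [/mapP [h hL ->]]] := gl g; first by rewrite msuppX mem_head.
  by rewrite lead_monX => hg /(antichain gL hL) gh; rewrite gh eqxx in hg.
Qed.

End MonomialIdeals.

(** * The monomial basis *)

Section Bases.
Variables (F : fieldType) (L : lmodType F).

Lemma is_basis_ext (I : eqType) (W W' : L -> Prop) (P P' : I -> Prop) e :
  (forall x, W x <-> W' x) -> (forall i, P i <-> P' i) ->
  is_basis W P e -> is_basis W' P' e.
Proof.
move=> WW PP [h1 h2 h3]; split=> [i /PP /h1 /WW //|s c us sP|x /WW/h3 [s [c [sP ->]]]].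
  by apply: h2 => // i /sP /PP.
by exists s, c; split=> // i /sP /PP.
Qed.

Lemma is_basis_reindex (I : eqType) (J : finType) (f : J -> I) (W : L -> Prop)
    (P : I -> Prop) e :
  injective f -> (forall i, P i <-> exists j, f j = i) ->
  is_basis W P e -> is_basis W (fun=> True) (e \o f).
Proof.
move=> finj Pf [h1 h2 h3]; split=> [j _|s c us _ sc0 j js|x /h3 [s [c [sP ->]]]].
- by apply/h1/Pf; exists j.
(* Independence is known for coefficients indexed by [I], so [c] is transported along the injection
   [f] and extended by 0. *)
- pose c' i := if [pick k | f k == i] is Some k then c k else 0.
  have c'f k : c' (f k) = c k.
    by rewrite /c'; case: pickP => [k' /eqP/finj -> //|/(_ k)/eqP].
  rewrite -c'f; apply: (h2 (map f s)); last exact: map_f.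
  + by rewrite map_inj_uniq.
  + by move=> _ /mapP [k _ ->]; apply/Pf; exists k.
  + by rewrite big_map -[RHS]sc0; apply: eq_bigr => k _; rewrite c'f.
- have [t ->] : exists t, s = map f t.
    elim: s sP => [|i s IH] sP; first by exists [::].
    have [|t ->] := IH; first by move=> k ks; apply: sP; rewrite inE ks orbT.
    by have /Pf [j <-] := sP i (mem_head _ _); exists (j :: t).
  by exists t, (c \o f); rewrite big_map.
Qed.

End Bases.

Section CoinvariantBasis.
Variables (F : fieldType) (m l p : nat) (M : 'M[F]_(dim23 m l)).
Hypotheses (p_pr : prime p) (p2 : (2 < p)%N) (pF : p \in [pchar F]) (MA : adapted_mx M).

(** Independence is [hilbertP] read at standard exponents; spanning holds because nonstandard
    monomials vanish. The predicate [Q] covers both the whole algebra and its homogeneous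
    components. *)
Lemma coinv_is_basis (Q : 'X_{1..dim23 m l} -> Prop) (W : coinv M -> Prop) :
  (forall x, W x <-> exists2 f, {in msupp f, forall a, Q a} & x = to_coinv M f) ->
  is_basis W (fun a => std p a /\ Q a) (fun a => to_coinv M 'X_[a]).
Proof.
move=> WQ; split=> [a [_ Qa]|s c us sP|x /WQ [f fQ ->]].
- by apply/WQ; exists 'X_[a] => // b; rewrite msuppX inE => /eqP ->.
- have -> : \sum_(a <- s) c a *: to_coinv M 'X_[a] =
      to_coinv M (\sum_(a <- s) c a *: 'X_[a]).
    by rewrite raddf_sum; apply: eq_bigr => a _; rewrite /= linearZ.
  move/coinv_eq0/(hilbertP p_pr p2 pF MA) => h a sa.
  have [stda _] := sP a sa; rewrite -(h a stda) raddf_sum /= (bigD1_seq a) //=.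
  rewrite mcoeffZ mcoeffX eqxx mulr1 big1 ?addr0 // => b ba.
  by rewrite mcoeffZ mcoeffX (negbTE ba) mulr0.
- exists [seq a <- msupp f | std p a], (fun a => f@_a); split.
    by move=> a; rewrite mem_filter => /andP[sa /fQ].
  rewrite [in LHS](mpolyE f) raddf_sum big_filter [in LHS](bigID (std p)) /=.
  rewrite [X in _ + X]big1 ?addr0 => [|a /(coinv_nonstd p_pr p2 pF MA) a0].
    by apply: eq_bigr => a _; rewrite /= linearZ.
  by rewrite linearZ /= a0 scaler0.
Qed.

End CoinvariantBasis.

Section TopMonomials.
Variables (m l p : nat).
Hypotheses (p1 : (1 < p)%N) (l0 : (0 < l)%N).
Implicit Types i j : 'I_(m + l).

Lemma standard_monE (F : fieldType) (a : 'X_{1..dim23 m l}) :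
  standard_mon (GB F m l p) a <-> std p a.
Proof.
rewrite GB_GBmon; split=> [h|/allP h _ /mapP [g gG ->]].
  by apply/allP => g gG; have := h _ (map_f _ gG); rewrite lead_monX.
by rewrite lead_monX; apply: h.
Qed.

Lemma sum_pred1 (P : pred 'I_(m + l)) i : (\sum_(k | P k) (k == i))%N = P i.
Proof.
have [Pi|nPi] := boolP (P i); last first.
  by rewrite big1 // => k Pk; case: eqP => // ki; rewrite -ki Pk in nPi.
rewrite (bigD1 i) //= eqxx big1 ?addn0 // => k /andP[_ /negbTE -> //].
Qed.

Lemma top_monX j i : top_mon p j (ixX i) = 0%N.
Proof.
rewrite mnmDE mulmnE mnmDE !mnm_sumE mnm1E eq_sym ixXY.
rewrite !big1 // => k km; rewrite mnm1E eq_sym ?ixXY //.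
by rewrite ixXZ.
Qed.

Lemma top_monY j i : (m <= j)%N ->
  top_mon p j (ixY i) = if (i < m)%N then p.-1 else (i == j).
Proof.
move=> jm; rewrite mnmDE mulmnE mnmDE !mnm_sumE mnm1E ixYY.
rewrite [X in ((_ + X) * _)%N]big1 => [|k km]; last by rewrite mnm1E eq_sym ixYZ.
rewrite (eq_bigr (fun k => (k == i) : nat)) => [|k _]; last by rewrite mnm1E ixYY.
rewrite sum_pred1 addn0 eq_sym; case: ltnP => [im|_].
  by rewrite mul1n; case: eqP => [ij|//]; rewrite ij ltnNge jm in im.
by rewrite mul0n addn0.
Qed.

Lemma top_monZ j i : (m <= i)%N -> top_mon p j (ixZ i) = p.-1.
Proof.
move=> im; rewrite mnmDE mulmnE mnmDE !mnm_sumE mnm1E ixYZ //.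
rewrite big1 => [|k km]; last by rewrite mnm1E ixYZ.
rewrite (eq_bigr (fun k => (k == i) : nat)) => [|k km]; last by rewrite mnm1E ixZZ.
by rewrite sum_pred1 im mul1n.
Qed.

(** A standard monomial contains at most one Y_j with j >= m, and with exponent at most 1; this j
    selects the top monomial. *)
Lemma std_divides_top (a : 'X_{1..dim23 m l}) : std p a <-> divides_top p a.
Proof.
split=> [sa|[j jm]]; last first.
  move=> /std_le; apply; have ltp : (p.-1 < p)%N by rewrite ltn_predL ltnW.
  apply/stdP; split=> [i|i im|i im|i k im km].
  - exact: top_monX.
  - by rewrite top_monY // im.
  - by rewrite top_monZ.
  - apply/mnm_lepP => /= h; have e (c : 'I_(m + l)) : (m <= c)%N -> (0 < top_mon p j (ixY c))%N -> c = j.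
      by move=> cm; rewrite top_monY // (ltnNge c) cm /=; case: eqP.
    have ij : i = j.
      by apply: e => //; apply: leq_trans (h _); rewrite mnmDE mnm1E eqxx.
    have kj : k = j.
      by apply: e => //; apply: leq_trans (h _); rewrite mnmDE !mnm1E eqxx addn1.
    have := h (ixY j); rewrite ij kj mnmDE !mnm1E eqxx top_monY // eqxx.
    by rewrite (ltnNge j) jm.
have [aX aY aZ _] := stdP _ _ sa.
have pred_le k : (k < p)%N -> (k <= p.-1)%N by case: (p) p1.
suff [j jm hj] : exists2 j : 'I_(m + l), (m <= j)%N &
    forall i : 'I_(m + l), (m <= i)%N -> (a (ixY i) <= (i == j))%N.
  exists j => //; apply/mnm_lepP; apply: ix_case => [i|i|i im].
  - by rewrite aX.
  - by rewrite top_monY //; case: ltnP => im; [apply/pred_le/aY | apply: hj].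
  - by rewrite top_monZ //; apply/pred_le/aZ.
case: (pickP (fun i : 'I_(m + l) => (m <= i)%N && (0 < a (ixY i))%N)).
  move=> j /andP[jm aj]; exists j => // i im; case: (eqVneq i j) => [->|ij].
    exact: (std_Yle1 sa).
  have := std_Y sa jm im aj; rewrite mnmBE mnm1E ixYY eq_sym (negbTE ij) subn0.
  by move=> ->.
(* When no such Y_j occurs any j >= m will do; the first block of type V_3 exists since l > 0. *)
move=> noY; exists (rshift m (Ordinal l0)) => [|i im]; first exact: leq_addr.
by have := noY i; rewrite /= im lt0n /= => /negbFE /eqP ->.
Qed.

End TopMonomials.

(** * The Hilbert series *)

Section HilbertSeries.
Variables (m l p : nat).
Local Notation N := (dim23 m l).
Local Notation T := ('I_l.+1 * {ffun 'I_(m + l) -> 'I_p})%type.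
Implicit Types (x : T) (i : 'I_(m + l)).

(* The factor Y_j with j >= m is the one of index j = m + x.1 - 1, and there is
   none when x.1 = 0. *)
Definition mon_of x : 'X_{1..N} :=
  [multinom by_kind (fun=> 0%N)
     (fun i => if (i < m)%N then x.2 i : nat else (i.+1 == m + x.1)%N : nat)
     (fun i => x.2 i : nat) c | c < N].

Definition deg_of x : nat := ((x.1 != ord0) + \sum_i x.2 i)%N.

Lemma mon_ofX x i : mon_of x (ixX i) = 0%N.
Proof. by rewrite mnmE by_kindX. Qed.
Lemma mon_ofY x i : mon_of x (ixY i) =
  if (i < m)%N then x.2 i : nat else (i.+1 == m + x.1)%N.
Proof. by rewrite mnmE by_kindY. Qed.
Lemma mon_ofZ x i : (m <= i)%N -> mon_of x (ixZ i) = x.2 i.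
Proof. by move=> im; rewrite mnmE by_kindZ. Qed.

Lemma sum_ix (f : 'I_N -> nat) : (\sum_c f c =
  \sum_(i < m + l) (f (ixX i) + f (ixY i) + if m <= i then f (ixZ i) else 0))%N.
Proof.
rewrite (reindex _ (onW_bij _ tagnat.rank_bij)) /=.
rewrite (eq_bigr (fun t => f (tagnat.Rank (tag t) (tagged t)))); last by case.
rewrite -(@sig_big_dep _ _ _ _ _ predT (fun _ => predT)
  (fun i (k : 'I_(sizes23 i)) => f (tagnat.Rank i k))) /=.
apply: eq_bigr => i _.
rewrite (eq_bigr (fun k : 'I_(sizes23 i) => f (ix i k))); last first.
  by move=> k _; rewrite /ix inord_val.
rewrite /sizes23 !big_ord_recl /= addnA; congr (_ + _)%N.
by case: (m <= i)%N; rewrite ?big_ord0 // big_ord_recl big_ord0 addn0.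
Qed.

Lemma mdeg_mon_of x : mdeg (mon_of x) = deg_of x.
Proof.
rewrite mdegE sum_ix /deg_of [RHS]addnC.
rewrite (eq_bigr (fun i => x.2 i + ((m <= i) && (i.+1 == m + x.1)) : nat)%N); last first.
  move=> i _; rewrite mon_ofX mon_ofY; case: ltnP => im; first by rewrite addn0.
  by rewrite mon_ofZ // addnC.
rewrite big_split /=; congr (_ + _)%N.
have [->|x0] := eqVneq x.1 ord0.
  (* For [x.1 = 0] the test [i.+1 == m] fails for every i >= m. *)
  by rewrite big1 // => i _; rewrite addn0 /=; case: leqP => //= im; rewrite gtn_eqF.
have x1 : (0 < x.1)%N by rewrite lt0n.
have jl : (m + x.1.-1 < m + l)%N by rewrite ltn_add2l -ltnS prednK // ltn_ord.
rewrite (bigD1 (Ordinal jl)) //= leq_addr -addnS prednK // eqxx big1 ?addn0 //.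
move=> i; rewrite -val_eqE /= => ij; apply/eqP; rewrite eqb0 negb_and.
by rewrite -(prednK x1) addnS eqSS ij orbT.
Qed.

Lemma mon_of_inj : injective mon_of.
Proof.
move=> [o f] [o' f'] /mnmP e; have ef : f = f'.
  apply/ffunP => i; apply: val_inj; have [im|im] := ltnP i m.
    by have := e (ixY i); rewrite !mon_ofY im.
  by have := e (ixZ i); rewrite !mon_ofZ.
congr (_, _) => //; apply: val_inj => /=.
(* A nonzero index is recovered from the block that it marks; by symmetry, only the case of two zero
   indices is then left. *)
have oo (u v : 'I_l.+1) : (forall i : 'I_(m + l), (m <= i)%N -> (i.+1 == m + u)%N = (i.+1 == m + v)%N) ->
    (0 < u)%N -> u = v :> nat.
  move=> h u0; have jl : (m + u.-1 < m + l)%N by rewrite ltn_add2l -ltnS prednK // ltn_ord.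
  have := h (Ordinal jl) (leq_addr _ _); rewrite /= -addnS prednK // eqxx.
  by rewrite eqn_add2l => /esym/eqP.
have E (i : 'I_(m + l)) : (m <= i)%N -> (i.+1 == m + o)%N = (i.+1 == m + o')%N.
  move=> im; have := e (ixY i); rewrite !mon_ofY ltnNge im /=.
  by case: (_ == _); case: (_ == _).
have [o0|/(oo _ _ E) //] := posnP o.
have [o0'|/(oo _ _ (fun i im => esym (E i im))) //] := posnP o'.
by rewrite o0 o0'.
Qed.

(** [x.2 i] is the exponent of the variable of block i that may occur up to p - 1, namely Y_i or
    Z_i; [x.1] marks the single Y_j with j >= m that may occur besides. *)
Lemma std_mon_of a : std p a <-> exists x, mon_of x = a.
Proof.
split=> [sa|[x <-]]; last first.
  apply/stdP; split=> [i|i im|i im|i j im jm].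
  - exact: mon_ofX.
  - by rewrite mon_ofY im.
  - by rewrite mon_ofZ.
  - apply/mnm_lepP => h.
    have e (c : 'I_(m + l)) : (m <= c)%N -> (0 < mon_of x (ixY c))%N -> c.+1 = (m + x.1)%N.
      by move=> cm; rewrite mon_ofY (ltnNge c) cm /= lt0b => /eqP.
    have ei : i.+1 = (m + x.1)%N.
      by apply: e => //; apply: leq_trans (h _); rewrite mnmDE mnm1E eqxx.
    have ej : j.+1 = (m + x.1)%N.
      by apply: e => //; apply: leq_trans (h _); rewrite mnmDE !mnm1E eqxx addn1.
    have ij : i = j by apply: val_inj; apply: succn_inj; rewrite ei ej.
    have := h (ixY i); rewrite -ij mnmDE !mnm1E eqxx mon_ofY (ltnNge i) im /=.
    by case: (_ == _).
have [aX aY aZ _] := stdP _ _ sa.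
pose v i := if (i < m)%N then a (ixY i) else a (ixZ i).
have vp i : (v i < p)%N by rewrite /v; case: (ltnP i m) => im; [apply: aY | apply: aZ].
pose f := [ffun i => Ordinal (vp i)].
suff [o ho] : exists o : 'I_l.+1, forall i, (m <= i)%N ->
    a (ixY i) = (i.+1 == m + o)%N.
  exists (o, f); apply/mnmP; apply: ix_case => [i|i|i im].
  - by rewrite mon_ofX aX.
  - by rewrite mon_ofY; case: ltnP => im; [rewrite ffunE /= /v im | rewrite ho].
  - by rewrite mon_ofZ //= ffunE /= /v ltnNge im.
case: (pickP (fun i : 'I_(m + l) => (m <= i)%N && (0 < a (ixY i))%N)).
  (* The index is shifted by one, since 0 stands for the absence of such a Y_j. *)
  move=> j /andP[jm aj]; have jl : (j.+1 - m < l.+1)%N.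
    by rewrite ltnS leq_subLR ltn_ord.
  exists (Ordinal jl) => i im; rewrite /= subnKC ?(leqW jm) // eqSS val_eqE.
  have := std_Y sa jm im aj; rewrite mnmBE mnm1E ixYY eq_sym.
  case: (eqVneq i j) => [->|_]; last by rewrite subn0.
  by move=> a0; apply/eqP; rewrite eqn_leq (std_Yle1 sa).
move=> noY; exists ord0 => i im; rewrite addn0 gtn_eqF //.
by apply/eqP; have := noY i; rewrite /= im lt0n /= => /negbFE.
Qed.

(** Expanding the product by distributivity gives one term for each element of [T]: the factor l t +
    1 chooses the optional Y_j, and each of the other factors chooses an exponent below p. *)
Lemma hilbert_poly_sum :
  (('X *+ l + 1) * (\sum_(i < p) 'X^i) ^+ (m + l) : {poly nat}) =
  \sum_(x : T) 'X^(deg_of x).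
Proof.
have -> : ('X *+ l + 1 : {poly nat}) = \sum_(o < l.+1) 'X^(o != ord0).
  rewrite big_ord_recl /= addrC expr0; congr (_ + _).
  by rewrite sumr_const card_ord expr1.
rewrite -[(m + l)%N in LHS]card_ord -prodr_const bigA_distr_bigA /=.
rewrite big_distrlr pair_bigA /=; apply: eq_bigr => x _.
by rewrite prodrXr -exprD.
Qed.

Variables (F : fieldType) (M : 'M[F]_N).
Hypotheses (p_pr : prime p) (p2 : (2 < p)%N) (pF : p \in [pchar F]) (MA : adapted_mx M).

(** The coefficient of t^d counts the elements of [T] of degree d, and [mon_of] turns these into the
    standard monomials of degree d. *)
Lemma coinv_hilbert_seriesP : coinv_hilbert_series M
  (('X *+ l + 1) * (\sum_(i < p) 'X^i) ^+ (m + l)).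
Proof.
move=> d; pose A := [set x : T | deg_of x == d].
have -> : ((('X *+ l + 1) * (\sum_(i < p) 'X^i) ^+ (m + l) : {poly nat})`_d)%R = #|A|.
  rewrite hilbert_poly_sum coef_sum -sum1_card big_mkcond /=.
  rewrite [RHS]big_mkcond /=.
  by apply: eq_bigr => x _; rewrite coefXn inE eq_sym; case: eqP.
pose f (k : 'I_#|A|) := mon_of (enum_val k).
exists (fun k => to_coinv M 'X_[f k]).
apply: (is_basis_reindex (f := f)
  (P := fun a => std p a /\ mdeg a = d) (e := fun a => to_coinv M 'X_[a])).
- by move=> i j /mon_of_inj /enum_val_inj.
- move=> a; split=> [[/std_mon_of [x <-]]|[k <-]].
    rewrite mdeg_mon_of => /eqP xd; have xA : x \in A by rewrite inE.
    by exists (enum_rank_in xA x); rewrite /f enum_rankK_in.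
  split; first by apply/std_mon_of; exists (enum_val k).
  by have := enum_valP k; rewrite inE mdeg_mon_of => /eqP.
- apply: (coinv_is_basis p_pr p2 pF MA) => x; split=> [[g /dhomogP gd ->]|[g gd ->]].
    by exists g.
  by exists g => //; apply/dhomogP.
Qed.

End HilbertSeries.

(** * Tensor products of coinvariants *)

Section LinearSubstitution.
Variables (F : fieldType) (k n : nat).

Definition lin_subst (A : 'M[F]_(k, n)) (f : {mpoly F[k]}) : {mpoly F[n]} :=
  f \mPo [tuple form (row i A) | i < k].
HB.instance Definition _ A := GRing.LRMorphism.copy (lin_subst A)
  (comp_mpoly [tuple form (row i A) | i < k]).

Lemma lin_subst_X A i : lin_subst A 'X_i = form (row i A).
Proof. by rewrite /lin_subst comp_mpolyXU -tnth_nth tnth_mktuple. Qed.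

Lemma lin_subst_homog A d f : f \is d.-homog -> lin_subst A f \is d.-homog.
Proof.
move=> /dhomogP fd; rewrite [f]mpolyE (raddf_sum (lin_subst A)) big_seq rpred_sum //.
move=> a /fd <-; rewrite /= [lin_subst _ _]linearZ rpredZ //= /lin_subst comp_mpolyX mdegE.
elim/big_rec2: _ => [|i x y _ h]; first exact: dhomog1.
apply: dhomogM => //; rewrite -[X in X.-homog]mul1n tnth_mktuple.
exact/dhomogMn/form_homog.
Qed.

End LinearSubstitution.

Lemma mpoly_rmorph_ext (F : fieldType) n (R : pzRingType)
    (f g : {rmorphism {mpoly F[n]} -> R}) :
  (forall c, f c%:MP = g c%:MP) -> (forall i, f 'X_i = g 'X_i) -> f =1 g.
Proof.
move=> fgC fgX u; rewrite [u]mpolyE !raddf_sum; apply: eq_bigr => a _ /=.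
rewrite -mul_mpolyC !rmorphM fgC mpolyXE_id !rmorph_prod; congr (_ * _).
by apply: eq_bigr => i _; rewrite !rmorphXn /= fgX.
Qed.

Lemma lin_subst_form (F : fieldType) k n (A : 'M[F]_(k, n)) u :
  lin_subst A (form u) = form (u *m A).
Proof.
rewrite /form (raddf_sum (lin_subst A)) -/(form _) mulmx_sum_row raddf_sum /=.
by apply: eq_bigr => i _; rewrite [lin_subst _ _]linearZ linearZ /= lin_subst_X.
Qed.

(** * Maps of coinvariants induced by equivariant linear maps *)

Section CoinvariantMap.
Variables (F : fieldType) (k n : nat) (A : 'M[F]_(k, n)) (Mk : 'M[F]_k) (M : 'M[F]_n).
Hypothesis AM : Mk *m A = A *m M.

Lemma lin_subst_sigma f : lin_subst A (sigma Mk f) = sigma M (lin_subst A f).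
Proof.
apply: (mpoly_rmorph_ext (f := lin_subst A \o sigma Mk) (g := sigma M \o lin_subst A)).
  by move=> c /=; rewrite /lin_subst /sigma !comp_mpolyC.
by move=> i /=; rewrite lin_subst_X sigma_X lin_subst_form sigma_form -!row_mul AM.
Qed.

(** An equivariant linear substitution sends invariants to invariants and preserves the degree. *)
Lemma lin_subst_hilbert f : f \in hilbert_ideal Mk -> lin_subst A f \in hilbert_ideal M.
Proof.
case/hilbert_idealP => s [sS ->]; apply/hilbert_idealP.
exists [seq (lin_subst A x.1, lin_subst A x.2) | x <- s]; split.
  move=> _ /mapP [x /sS [xM [d d0 xd]] ->]; split; first by rewrite -lin_subst_sigma xM.
  by exists d => //; apply: lin_subst_homog.
by rewrite big_map raddf_sum; apply: eq_bigr => x _; rewrite /= rmorphM.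
Qed.

(* The proof argument lets the algebra morphism structure be inferred. *)
Definition coinv_map of Mk *m A = A *m M := fun x : coinv Mk =>
  to_coinv M (lin_subst A (repr x)).
Local Notation phi := (coinv_map AM).

Lemma coinv_mapE f : phi (to_coinv Mk f) = to_coinv M (lin_subst A f).
Proof.
apply/eqP; rewrite -subr_eq0 /coinv_map -!rmorphB; apply/eqP/coinv_eq0.
by apply/lin_subst_hilbert/coinv_eq0; rewrite rmorphB /= to_coinvK subrr.
Qed.

Fact coinv_map_is_zmod_morphism : zmod_morphism phi.
Proof.
move=> x y; rewrite -[x]to_coinvK -[y]to_coinvK -rmorphB.
by rewrite !coinv_mapE !rmorphB.
Qed.

Fact coinv_map_is_monoid_morphism : monoid_morphism phi.
Proof.
split=> [|x y].
  by rewrite -[X in phi X](rmorph1 (to_coinv Mk)) coinv_mapE !rmorph1.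
rewrite -[x]to_coinvK -[y]to_coinvK -rmorphM.
by rewrite !coinv_mapE !rmorphM.
Qed.

Fact coinv_map_is_scalable : scalable phi.
Proof.
move=> c x; rewrite -[x]to_coinvK -linearZ /= !coinv_mapE.
by rewrite [lin_subst _ _]linearZ [to_coinv _ _]linearZ.
Qed.

HB.instance Definition _ :=
  GRing.isZmodMorphism.Build (coinv Mk) (coinv M) phi coinv_map_is_zmod_morphism.
HB.instance Definition _ :=
  GRing.isMonoidMorphism.Build (coinv Mk) (coinv M) phi coinv_map_is_monoid_morphism.
HB.instance Definition _ :=
  GRing.isScalable.Build F (coinv Mk) (coinv M) *:%R phi coinv_map_is_scalable.

Lemma coinv_map_sigma x : phi (coinv_sigma x) = coinv_sigma (phi x).
Proof. by rewrite -[x]to_coinvK coinv_sigmaE !coinv_mapE coinv_sigmaE lin_subst_sigma. Qed.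

End CoinvariantMap.


(** * The tensor product as a commutative algebra *)

Section CommutativeTensor.
Variables (F : fieldType) (A B : comAlgType F).

(* An alias, so that recording commutativity leaves the structures found on
   tensor A B unchanged. *)
Definition ctensor : Type := tensor A B.
HB.instance Definition _ := GRing.PzRing.on ctensor.
HB.instance Definition _ := GRing.Lmodule.on ctensor.

Fact ctensor_mulC (t u : ctensor) : t * u = u * t.
Proof.
rewrite -[t]reprK -[u]reprK -!/(tsum _).
rewrite [LHS]tensor_mul_tsum [RHS]tensor_mul_tsum exchange_big /=.
by apply: eq_bigr => x _; apply: eq_bigr => y _; rewrite mulrC [X in pure _ X]mulrC.
Qed.

HB.instance Definition _ := GRing.PzRing_hasCommutativeMul.Build ctensor ctensor_mulC.

Lemma ctensor_sum (t : ctensor) : exists s : seq (A * B),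
  t = \sum_(x <- s) (pure x.1 x.2 : ctensor).
Proof. by exists (repr t); rewrite -[LHS]reprK -/(tsum _) tsumE. Qed.

Definition inl_tensor (x : A) : ctensor := pure x 1.
Definition inr_tensor (y : B) : ctensor := pure 1 y.

Fact inl_tensor_is_linear : linear inl_tensor.
Proof. exact: (pure_bilinear A B).1. Qed.
Fact inl_tensor_is_monoid_morphism : monoid_morphism inl_tensor.
Proof. by split=> // x y; rewrite /inl_tensor [RHS]tensor_mul_pure mulr1. Qed.
HB.instance Definition _ := GRing.isLinear.Build F A ctensor *:%R inl_tensor
  inl_tensor_is_linear.
HB.instance Definition _ := GRing.isMonoidMorphism.Build A ctensor inl_tensor
  inl_tensor_is_monoid_morphism.

Fact inr_tensor_is_linear : linear inr_tensor.
Proof. exact: (pure_bilinear A B).2. Qed.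
Fact inr_tensor_is_monoid_morphism : monoid_morphism inr_tensor.
Proof. by split=> // x y; rewrite /inr_tensor [RHS]tensor_mul_pure mulr1. Qed.
HB.instance Definition _ := GRing.isLinear.Build F B ctensor *:%R inr_tensor
  inr_tensor_is_linear.
HB.instance Definition _ := GRing.isMonoidMorphism.Build B ctensor inr_tensor
  inr_tensor_is_monoid_morphism.

Lemma pure_inl_inr x y : pure x y = inl_tensor x * inr_tensor y :> ctensor.
Proof. by rewrite [RHS]tensor_mul_pure mulr1 mul1r. Qed.

Lemma ctensor_scaleE c (t : ctensor) : c *: t = inl_tensor c%:A * t.
Proof.
have [s ->] := ctensor_sum t; rewrite scaler_sumr mulr_sumr.
apply: eq_bigr => x _; rewrite !pure_inl_inr mulrA -rmorphM /= -scalerAl mul1r.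
by rewrite -!pure_inl_inr; apply/esym/(bilinearZl (pure_bilinear A B)).
Qed.

End CommutativeTensor.

(** * Evaluation of polynomials *)

Section Evaluation.
Variables (R : nzRingType) (n : nat) (S : comPzRingType).
Variables (kappa : {rmorphism R -> S}) (h : 'I_n -> S).

(* The evaluation mmap of mpoly, for a possibly trivial target ring. *)
Definition pz_mmap (f : {mpoly R[n]}) : S :=
  \sum_(a <- msupp f) kappa f@_a * \prod_i h i ^+ a i.

(** Summing over a fixed finite set of exponents allows polynomials with different supports to be
    compared. *)
Lemma pz_mmapE f k : (msize f <= k)%N -> pz_mmap f =
  \sum_(a : 'X_{1..n < k}) kappa f@_a * \prod_i h i ^+ a i.
Proof.
move=> fk; rewrite /pz_mmap (big_mksub 'X_{1..n < k}) ?msupp_uniq //=; first last.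
  by move=> a /msize_mdeg_lt /leq_trans; apply.
by rewrite big_rmcond //= => a /memN_msupp_eq0 ->; rewrite rmorph0 mul0r.
Qed.

Lemma pz_mmapX a : pz_mmap 'X_[a] = \prod_i h i ^+ a i.
Proof. by rewrite /pz_mmap msuppX big_seq1 mcoeffX eqxx rmorph1 mul1r. Qed.

Lemma pz_mmapXU i : pz_mmap 'X_i = h i.
Proof.
rewrite pz_mmapX (bigD1 i) //= mnm1E eqxx big1 ?mulr1 // => j ji.
by rewrite mnm1E eq_sym (negbTE ji).
Qed.

Fact pz_mmap_is_zmod_morphism : zmod_morphism pz_mmap.
Proof.
move=> f g; pose k := maxn (msize (f - g)) (maxn (msize f) (msize g)).
rewrite !(@pz_mmapE _ k) ?leq_max ?leqnn ?orbT // -sumrB.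
by apply: eq_bigr => a _; rewrite mcoeffB rmorphB mulrBl.
Qed.

HB.instance Definition _ := GRing.isZmodMorphism.Build {mpoly R[n]} S pz_mmap
  pz_mmap_is_zmod_morphism.

Lemma pz_mmapZ c f : pz_mmap (c *: f) = kappa c * pz_mmap f.
Proof.
pose k := maxn (msize (c *: f)) (msize f).
rewrite !(@pz_mmapE _ k) ?leq_max ?leqnn ?orbT // mulr_sumr.
by apply: eq_bigr => a _; rewrite mcoeffZ rmorphM mulrA.
Qed.

Fact pz_mmap_is_monoid_morphism : monoid_morphism pz_mmap.
Proof.
split=> [|f g].
  by rewrite -mpolyX0 pz_mmapX big1 // => i _; rewrite mnm0E.
rewrite mpolyME raddf_sum /= big_allpairs /=.
rewrite [in RHS]/pz_mmap big_distrlr /=; apply: eq_bigr => a _; apply: eq_bigr => b _.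
rewrite pz_mmapZ rmorphM pz_mmapX mulrACA -big_split; congr (_ * _).
by apply: eq_bigr => i _; rewrite mnmDE exprD.
Qed.

HB.instance Definition _ := GRing.isMonoidMorphism.Build {mpoly R[n]} S pz_mmap
  pz_mmap_is_monoid_morphism.

End Evaluation.

(** * The isomorphism with the tensor product *)

Section TensorIso.
Variables (F : fieldType) (m l p k2 k3 : nat).
Local Notation N := (dim23 m l).
Variables (M : 'M[F]_N) (M2 : 'M[F]_k2) (M3 : 'M[F]_k3).
Variables (A2 : 'M[F]_(k2, N)) (D2 : 'M[F]_(N, k2)).
Variables (A3 : 'M[F]_(k3, N)) (D3 : 'M[F]_(N, k3)).
Hypotheses (p_pr : prime p) (p2 : (2 < p)%N) (pF : p \in [pchar F]).
Hypothesis MA : adapted_mx M.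
Hypotheses (AD22 : A2 *m D2 = 1%:M) (AD23 : A2 *m D3 = 0).
Hypotheses (AD32 : A3 *m D2 = 0) (AD33 : A3 *m D3 = 1%:M).
Hypothesis DA : D2 *m A2 + D3 *m A3 = 1%:M.
Hypotheses (MA2 : M2 *m A2 = A2 *m M) (MA3 : M3 *m A3 = A3 *m M).
Hypothesis M2M2 : M2 *m M2 = M2 + M2 - 1%:M.
Implicit Types (i j : 'I_(m + l)) (c : 'I_N).

Local Notation C2 := (coinv M2).
Local Notation C3 := (coinv M3).
Local Notation T := (ctensor C2 C3).

(** Row vectors being linear forms, [A2] and [A3] are the inclusions of the two summands of V^*, and
    [D2] and [D3] the projections onto them. The projections inherit equivariance from the
    inclusions, through the decomposition [DA] of the identity. *)
Let D2M : D2 *m M2 = M *m D2.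
Proof.
rewrite -[M in RHS]mul1mx -DA !mulmxDl -!mulmxA !(mulmxA _ M) -MA2 -MA3.
by rewrite -!mulmxA AD22 AD32 !mulmx0 addr0 mulmx1.
Qed.
Let D3M : D3 *m M3 = M *m D3.
Proof.
rewrite -[M in RHS]mul1mx -DA !mulmxDl -!mulmxA !(mulmxA _ M) -MA2 -MA3.
by rewrite -!mulmxA AD23 AD33 !mulmx0 add0r mulmx1.
Qed.

Definition ctensor_scalar (e : F) : T := inl_tensor C3 e%:A.
HB.instance Definition _ := GRing.RMorphism.copy ctensor_scalar
  (@inl_tensor F C2 C3 \o in_alg C2).

(** An adapted basis need not be compatible with the decomposition of V^*, so a variable may have a
    nonzero component in each summand. *)
Definition split_var c : T :=
  inl_tensor C3 (to_coinv M2 (form (row c D2))) +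
  inr_tensor C2 (to_coinv M3 (form (row c D3))).

Definition split_poly : {mpoly F[N]} -> T := pz_mmap ctensor_scalar split_var.
HB.instance Definition _ := GRing.RMorphism.copy split_poly
  (pz_mmap ctensor_scalar split_var).

Lemma split_polyZ e f : split_poly (e *: f) = e *: split_poly f.
Proof. by rewrite ctensor_scaleE; apply: pz_mmapZ. Qed.

Lemma split_polyXU c : split_poly 'X_c = split_var c.
Proof. exact: pz_mmapXU. Qed.

Lemma split_form u : split_poly (form u) =
  inl_tensor C3 (to_coinv M2 (form (u *m D2))) +
  inr_tensor C2 (to_coinv M3 (form (u *m D3))).
Proof.
rewrite {1}/form (raddf_sum split_poly) /=.
rewrite (eq_bigr (fun c => u 0 c *: split_var c)) => [|c _]; last first.
  by rewrite split_polyZ split_polyXU.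
rewrite !mulmx_sum_row !(raddf_sum (@form F _)) (raddf_sum (to_coinv M2)).
rewrite (raddf_sum (to_coinv M3)) !raddf_sum -big_split /=.
by apply: eq_bigr => c _; rewrite /split_var scalerDr !linearZ.
Qed.


Let eX i : delta_mx 0 (ixX i) *m M = delta_mx 0 (ixX i) :> 'rV_N.
Proof. by rewrite -rowE; case: MA. Qed.
Let eY i : delta_mx 0 (ixY i) *m M = delta_mx 0 (ixY i) + delta_mx 0 (ixX i) :> 'rV_N.
Proof. by rewrite -rowE; case: MA. Qed.
Let eZ i : (m <= i)%N ->
  delta_mx 0 (ixZ i) *m M = delta_mx 0 (ixZ i) + delta_mx 0 (ixY i) :> 'rV_N.
Proof. by move=> im; rewrite -rowE; case: MA => _ _; apply. Qed.

Section Rows.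
Variables (k : nat) (D : 'M[F]_(N, k)) (M' : 'M[F]_k).
Hypothesis DM : D *m M' = M *m D.

(** The rows of an equivariant [D] are the images of the variables, so they satisfy the same
    equations under sigma, and the relations of the Hilbert ideal follow for them. *)
Lemma rowX i : row (ixX i) D *m M' = row (ixX i) D.
Proof. by rewrite !rowE -mulmxA DM mulmxA eX. Qed.
Lemma rowY i : row (ixY i) D *m M' = row (ixY i) D + row (ixX i) D.
Proof. by rewrite !rowE -mulmxA DM mulmxA eY mulmxDl. Qed.
Lemma rowZ i : (m <= i)%N ->
  row (ixZ i) D *m M' = row (ixZ i) D + row (ixY i) D.
Proof. by move=> im; rewrite !rowE -mulmxA DM mulmxA eZ // mulmxDl. Qed.

Lemma coinv_rowX i : to_coinv M' (form (row (ixX i) D)) = 0.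
Proof. exact/coinv_form_invariant/rowX. Qed.

Lemma coinv_rowYp i : to_coinv M' (form (row (ixY i) D)) ^+ p = 0.
Proof.
rewrite -rmorphXn; apply: (coinv_form_expp p_pr p2 pF (rowY i) (x := 0)).
- by rewrite rowX addr0.
- by rewrite mul0mx.
- by rewrite rmorphM /= coinv_rowX mul0r.
Qed.

Lemma coinv_rowYY i j : (m <= i)%N -> (m <= j)%N ->
  to_coinv M' (form (row (ixY i) D)) * to_coinv M' (form (row (ixY j) D)) = 0.
Proof.
move=> im jm; rewrite -rmorphM.
exact: coinv_form_mul (rowZ im) (rowY i) (rowX i) (rowZ jm) (rowY j) (rowX j).
Qed.

Lemma coinv_rowZp i : (m <= i)%N -> to_coinv M' (form (row (ixZ i) D)) ^+ p = 0.
Proof.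
move=> im; rewrite -rmorphXn.
apply: (coinv_form_expp p_pr p2 pF (rowZ im) (rowY i) (rowX i)).
by rewrite rmorphM coinv_rowYY.
Qed.

End Rows.

(* On the dual of m V_2, Delta^2 = 0, so Delta z is invariant for every z. *)
Lemma coinv_rowY2 i : (m <= i)%N -> to_coinv M2 (form (row (ixY i) D2)) = 0.
Proof.
move=> im; apply: coinv_form_invariant.
have -> : row (ixY i) D2 = row (ixZ i) D2 *m M2 - row (ixZ i) D2.
  by rewrite (rowZ D2M im) addrC addKr.
rewrite mulmxBl -mulmxA M2M2 mulmxBr mulmxDr mulmx1.
by rewrite addrAC addrK.
Qed.

(** The middle terms of the binomial formula have coefficients that vanish in F. *)
Lemma ctensor_exprD (x y : T) : x ^+ p = 0 -> y ^+ p = 0 -> (x + y) ^+ p = 0.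
Proof.
move=> xp yp; rewrite exprDn big1 // => -[i ip] _ /=.
have [->|i0] := posnP i; first by rewrite subn0 xp mul0r mul0rn.
have [->|ni] := eqVneq i p; first by rewrite yp mulr0 mul0rn.
rewrite -scaler_nat; have -> : 'C(p, i)%:R = 0 :> F; last by rewrite scale0r.
by apply/eqP; rewrite -(dvdn_pcharf pF) prime_dvd_bin // i0 ltn_neqAle ni -ltnS.
Qed.

(** The powers vanish componentwise, by additivity of the p-th power. For Y_i Y_j, mixed products of
    the two components would remain, but the components in the V_2 part are already 0 by
    [coinv_rowY2]. *)
Lemma split_GBmon g : g \in GBmon m l p -> split_poly 'X_[g] = 0.
Proof.
case/GBmonP => [i|i im|i im|i j im jm].
- by rewrite split_polyXU /split_var (coinv_rowX D2M) (coinv_rowX D3M) !raddf0 addr0.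
- rewrite -mpolyXn rmorphXn /= split_polyXU.
  by apply: ctensor_exprD; rewrite -rmorphXn /= (coinv_rowYp D2M, coinv_rowYp D3M) raddf0.
- rewrite -mpolyXn rmorphXn /= split_polyXU.
  by apply: ctensor_exprD; rewrite -rmorphXn /= (coinv_rowZp D2M im, coinv_rowZp D3M im) raddf0.
- rewrite mpolyXD rmorphM /= !split_polyXU /split_var !coinv_rowY2 // !raddf0 !add0r.
  by rewrite -rmorphM /= (coinv_rowYY D3M im jm) raddf0.
Qed.

(** By [hilbertP] the Hilbert ideal is spanned by the multiples of the monomials of [GBmon], so it
    suffices to treat these. *)
Lemma split_hilbert f : f \in hilbert_ideal M -> split_poly f = 0.
Proof.
move=> /(hilbertP p_pr p2 pF MA) f0; rewrite [f]mpolyE raddf_sum /= big1 // => a _.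
rewrite split_polyZ; have [/f0 ->|] := boolP (std p a); first by rewrite scale0r.
rewrite /std -has_predC => /hasP [g gG] /= /negPn ga.
by rewrite -(submK ga) mpolyXD rmorphM /= (split_GBmon gG) mulr0 scaler0.
Qed.

Definition coinv_split (x : coinv M) : tensor C2 C3 := split_poly (repr x).

Lemma coinv_splitE f : coinv_split (to_coinv M f) = split_poly f.
Proof.
apply/eqP; rewrite -subr_eq0 /coinv_split -[X in X == _]rmorphB; apply/eqP.
by apply/split_hilbert/coinv_eq0; rewrite rmorphB /= to_coinvK subrr.
Qed.

Fact coinv_split_is_zmod_morphism : zmod_morphism coinv_split.
Proof.
move=> x y; rewrite -[x]to_coinvK -[y]to_coinvK -rmorphB !coinv_splitE.
exact: rmorphB.
Qed.

Fact coinv_split_is_monoid_morphism : monoid_morphism coinv_split.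
Proof.
split=> [|x y].
  by rewrite -[X in coinv_split X](rmorph1 (to_coinv M)) coinv_splitE rmorph1.
rewrite -[x]to_coinvK -[y]to_coinvK -rmorphM !coinv_splitE.
exact: rmorphM.
Qed.

Fact coinv_split_is_scalable : scalable coinv_split.
Proof.
move=> e x; rewrite -[x]to_coinvK -linearZ /= !coinv_splitE.
exact: split_polyZ.
Qed.

HB.instance Definition _ := GRing.isZmodMorphism.Build (coinv M) (tensor C2 C3)
  coinv_split coinv_split_is_zmod_morphism.
HB.instance Definition _ := GRing.isMonoidMorphism.Build (coinv M) (tensor C2 C3)
  coinv_split coinv_split_is_monoid_morphism.
HB.instance Definition _ := GRing.isScalable.Build F (coinv M) (tensor C2 C3) *:%R
  coinv_split coinv_split_is_scalable.

Definition coinv_mul (x : C2) (y : C3) : coinv M :=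
  coinv_map MA2 x * coinv_map MA3 y.

Lemma coinv_mul_bilinear : is_bilinear coinv_mul.
Proof.
split=> [y e u v|x e u v]; rewrite /coinv_mul linearP.
  by rewrite mulrDl scalerAl.
by rewrite mulrDr scalerAr.
Qed.

Definition coinv_join : T -> coinv M := tensor_lift coinv_mul.

Lemma coinv_join_pure x y : coinv_join (pure x y) = coinv_mul x y.
Proof. exact: tensor_lift_pure coinv_mul_bilinear. Qed.

HB.instance Definition _ := GRing.isLinear.Build F T (coinv M) *:%R coinv_join
  (tensor_lift_linear coinv_mul_bilinear).

Fact coinv_join_is_monoid_morphism : monoid_morphism coinv_join.
Proof.
split=> [|t u]; first by rewrite [LHS]coinv_join_pure /coinv_mul !rmorph1 mulr1.
have [s ->] := ctensor_sum t; have [s' ->] := ctensor_sum u.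
rewrite [X in coinv_join X]big_distrlr /= !raddf_sum [RHS]big_distrlr /=.
apply: eq_bigr => x _; rewrite raddf_sum; apply: eq_bigr => y _ /=.
rewrite [X in coinv_join X]tensor_mul_pure !coinv_join_pure /coinv_mul !rmorphM.
by rewrite mulrACA.
Qed.
HB.instance Definition _ := GRing.isMonoidMorphism.Build T (coinv M) coinv_join
  coinv_join_is_monoid_morphism.

(** Both sides are ring morphisms on polynomials, so constants and variables suffice; on a variable,
    the two components add up to it by [DA]. *)
Lemma coinv_splitK : cancel coinv_split coinv_join.
Proof.
move=> x; rewrite -[x]to_coinvK coinv_splitE.
apply: (mpoly_rmorph_ext (f := coinv_join \o split_poly) (g := to_coinv M)).
  move=> e /=; rewrite -alg_mpolyC split_polyZ linearZ [RHS]linearZ.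
  by rewrite !rmorph1.
move=> c /=; rewrite split_polyXU /split_var raddfD /= !coinv_join_pure.
rewrite /coinv_mul !rmorph1 mulr1 mul1r !coinv_mapE !lin_subst_form -!row_mul.
rewrite -[in LHS]rmorphD -[in LHS]raddfD /= -[X in form X]raddfD /= DA.
by rewrite row1 form_delta.
Qed.

(** By multiplicativity each tensor factor can be treated alone; there, projecting after including
    gives the identity or 0. *)
Lemma coinv_split_pure x y : coinv_split (coinv_mul x y) = pure x y.
Proof.
have spl2 z : coinv_split (coinv_map MA2 z) = inl_tensor C3 z.
  rewrite -[z]to_coinvK coinv_mapE coinv_splitE.
  apply: (mpoly_rmorph_ext (f := split_poly \o lin_subst A2)
    (g := inl_tensor C3 \o to_coinv M2)).
    move=> e /=; rewrite -!alg_mpolyC [lin_subst _ _]linearZ split_polyZ.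
    by rewrite linearZ [RHS]linearZ !rmorph1.
  move=> c /=; rewrite lin_subst_X split_form -!row_mul AD22 AD23 row1 row0.
  by rewrite !raddf0 addr0 form_delta.
have spl3 z : coinv_split (coinv_map MA3 z) = inr_tensor C2 z.
  rewrite -[z]to_coinvK coinv_mapE coinv_splitE.
  apply: (mpoly_rmorph_ext (f := split_poly \o lin_subst A3)
    (g := @inr_tensor F C2 C3 \o to_coinv M3)).
    move=> e /=; rewrite -!alg_mpolyC [lin_subst _ _]linearZ split_polyZ.
    by rewrite linearZ [RHS]linearZ !rmorph1.
  move=> c /=; rewrite lin_subst_X split_form -!row_mul AD32 AD33 row1 row0.
  by rewrite !raddf0 add0r form_delta.
by rewrite /coinv_mul rmorphM /= spl2 spl3 [RHS]pure_inl_inr.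
Qed.

Lemma coinv_joinK : cancel coinv_join coinv_split.
Proof.
move=> t; have [s ->] := ctensor_sum t.
rewrite (raddf_sum coinv_join) (raddf_sum coinv_split) [LHS](eq_bigr (fun x => pure x.1 x.2)) // => x _ /=.
by rewrite coinv_join_pure coinv_split_pure.
Qed.

Lemma tensor_map_bilinear (f : {linear C2 -> C2}) (g : {linear C3 -> C3}) :
  is_bilinear (fun x y => pure (f x) (g y) : tensor C2 C3).
Proof.
split=> z e u v; rewrite linearP; first exact: (pure_bilinear C2 C3).1.
exact: (pure_bilinear C2 C3).2.
Qed.

(** Equivariance is easier for this direction: on pure tensors it is that of the two maps
    [coinv_map]. The inverse then inherits it. *)
Lemma coinv_join_sigma t : coinv_sigma (coinv_join t) =
  coinv_join (tensor_map (@coinv_sigma _ _ M2) (@coinv_sigma _ _ M3) t).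
Proof.
have [s ->] := ctensor_sum t.
have -> : tensor_map (@coinv_sigma _ _ M2) (@coinv_sigma _ _ M3)
    (\sum_(x <- s) (pure x.1 x.2 : T)) =
    \sum_(x <- s) (pure (coinv_sigma x.1) (coinv_sigma x.2) : T).
  have sE : \sum_(x <- s) (pure x.1 x.2 : T) = tsum s by rewrite tsumE.
  rewrite sE; exact: (tensor_lift_tsum s (tensor_map_bilinear (@coinv_sigma _ _ M2) (@coinv_sigma _ _ M3))).
rewrite !(raddf_sum coinv_join) (raddf_sum (@coinv_sigma _ _ M)).
by apply: eq_bigr => x _ /=; rewrite !coinv_join_pure /coinv_mul rmorphM /= !coinv_map_sigma.
Qed.

Lemma coinv_tensor : exists h : {lrmorphism coinv M -> tensor C2 C3},
  bijective h /\
  forall x, h (coinv_sigma x) =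
            tensor_map (@coinv_sigma _ _ M2) (@coinv_sigma _ _ M3) (h x).
Proof.
exists coinv_split; split.
  exact: (Bijective coinv_splitK coinv_joinK).
by move=> x /=; rewrite -{1}[x]coinv_splitK coinv_join_sigma coinv_joinK.
Qed.

End TensorIso.

(** * Splitting of the representation *)

Section JordanSums.
Variable F : fieldType.

(** The transpose is lower triangular with 1 on the diagonal. *)
Lemma jordan_block_unit k : jordan_block F k \in unitmx.
Proof.
rewrite unitmxE -det_tr det_trig.
  rewrite big1 ?unitr1 // => i _.
  by rewrite !mxE eqxx -[X in (X == _)%:R]addn1 -[X in (_ == X)%:R]addn0 eqn_add2l addr0.
apply/is_trig_mxP => i j ij; rewrite !mxE.
by rewrite -val_eqE /= !gtn_eqF ?addr0 // ltnW.
Qed.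

Lemma mul_mxdiag k (s : 'I_k -> nat) (A B : forall i, 'M[F]_(s i)) :
  \mxdiag_i A i *m \mxdiag_i B i = \mxdiag_i (A i *m B i).
Proof.
rewrite {2}/mxdiag mul_mxdiag_mxblock /mxdiag; apply/eq_mxblock => i j.
by case: eqP => [<-|_]; rewrite ?conform_mx_id ?mulmx0.
Qed.

Lemma sumV_unit k (s : 'I_k -> nat) : sumV F s \in unitmx.
Proof.
suff /mulmx1_unit [] : sumV F s *m \mxdiag_i invmx (jordan_block F (s i)) = 1%:M by [].
rewrite /sumV mul_mxdiag -mxdiagZ; apply: eq_mxdiag => i.
by rewrite mulmxV // jordan_block_unit.
Qed.

(** This is (g - 1)^2 = 0, true for each Jordan block of size 2. *)
Lemma sumV2_mul m : sumV F (@sizes2 m) *m sumV F (@sizes2 m) =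
  sumV F (@sizes2 m) + sumV F (@sizes2 m) - 1%:M.
Proof.
rewrite /sumV mul_mxdiag -mxdiagZ -mxdiagD -mxdiagB; apply: eq_mxdiag => i.
apply/matrixP => a b; rewrite !mxE !big_ord_recl big_ord0 !mxE.
case: a => [[|[|a]] // ?]; case: b => [[|[|b]] // ?];
  rewrite -!val_eqE /= ; ring.
Qed.

Lemma eq_sig12 k (s : 'I_k -> nat) (a b : 'I_(\sum_(i < k) s i)) :
  (a == b) = (tagnat.sig1 a == tagnat.sig1 b) &&
             (tagnat.sig2 a == tagnat.sig2 b :> nat).
Proof. by rewrite -tagnat.eq_Rank !tagnat.sig2K. Qed.

Lemma sumVE k (s : 'I_k -> nat) a b : sumV F s a b =
  ((tagnat.sig1 a == tagnat.sig1 b) && (tagnat.sig2 a == tagnat.sig2 b :> nat))%:R +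
  ((tagnat.sig1 a == tagnat.sig1 b) && ((tagnat.sig2 a).+1 == tagnat.sig2 b))%:R.
Proof.
rewrite /sumV !mxE; move: (tagnat.sig2 a) (tagnat.sig2 b).
move: (tagnat.sig1 a) (tagnat.sig1 b) => i j; case: (i =P j) => [<-|_] u v.
  by rewrite conform_mx_id !mxE.
by rewrite mxE addr0.
Qed.

Definition select_mx k n (w : 'I_k -> 'I_n) : 'M[F]_(k, n) :=
  \matrix_(r, c) (w r == c)%:R.

Lemma row_select k n (w : 'I_k -> 'I_n) r : row r (select_mx w) = delta_mx 0 (w r).
Proof. by apply/rowP => c; rewrite !mxE eqxx eq_sym. Qed.

Lemma select_mul k n k' (w : 'I_k -> 'I_n) (A : 'M[F]_(n, k')) :
  select_mx w *m A = \matrix_(r, c) A (w r) c.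
Proof.
by apply/row_matrixP => r; rewrite row_mul row_select -rowE; apply/rowP => c; rewrite !mxE.
Qed.

Lemma mul_select_tr k n k' (w : 'I_k -> 'I_n) (A : 'M[F]_(k', n)) :
  A *m (select_mx w)^T = \matrix_(r, c) A r (w c).
Proof.
by apply: trmx_inj; rewrite trmx_mul trmxK select_mul; apply/matrixP => r c; rewrite !mxE.
Qed.

End JordanSums.

(** * The summands m V_2 and l V_3 in coordinates *)

Section Splitting.
Variables (F : fieldType) (m l : nat).
Local Notation N := (dim23 m l).

(** [ix_of2] and [ix_of3] embed the coordinates of the two summands into those of V. On linear
    forms, the matrices [J2] and [J3] are then extension by 0, and their transposes restriction. *)
Definition ix_of2 (r : 'I_(\sum_(i < m) sizes2 i)) : 'I_N :=
  ix (lshift l (tagnat.sig1 r)) (tagnat.sig2 r).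
Definition ix_of3 (r : 'I_(\sum_(i < l) sizes3 i)) : 'I_N :=
  ix (rshift m (tagnat.sig1 r)) (tagnat.sig2 r).

Lemma sig1_ix (i : 'I_(m + l)) k : tagnat.sig1 (ix i k) = i.
Proof. exact: tagnat.Rank1K. Qed.

Lemma sig2_ix (i : 'I_(m + l)) k : (k < sizes23 i)%N -> tagnat.sig2 (ix i k) = k :> nat.
Proof. by move=> ki; rewrite /ix tagnat.Rank2K /= inordK. Qed.

Lemma sig2_ix_of2 r : tagnat.sig2 (ix_of2 r) = tagnat.sig2 r :> nat.
Proof. by rewrite sig2_ix //; apply: leq_trans (ltn_ord _) _. Qed.
Lemma sig2_ix_of3 r : tagnat.sig2 (ix_of3 r) = tagnat.sig2 r :> nat.
Proof. by rewrite sig2_ix //= /sizes23 /= leq_addr. Qed.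

Lemma ix_of_cover (c : 'I_N) :
  (exists r, ix_of2 r = c) \/ (exists r, ix_of3 r = c).
Proof.
have [i [k [ki ->]]] := ix_cover c.
case: (split_ordP i) ki => j -> ki; [left | right].
  have k2 : (k < @sizes2 m j)%N by move: ki; rewrite /sizes23 /= (leqNgt m) ltn_ord.
  exists (tagnat.Rank j (Ordinal k2)).
  by rewrite /ix_of2 tagnat.Rank2K /= tagnat.Rank1K.
have k3 : (k < @sizes3 l j)%N by move: ki; rewrite /sizes23 /= leq_addr.
exists (tagnat.Rank j (Ordinal k3)).
by rewrite /ix_of3 tagnat.Rank2K /= tagnat.Rank1K.
Qed.

Local Notation J2 := (select_mx F ix_of2).
Local Notation J3 := (select_mx F ix_of3).
Local Notation g := (sumV F (@sizes23 m l)).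

Lemma sig1_ix_of23 r s :
  (tagnat.sig1 (ix_of2 r) == tagnat.sig1 (ix_of3 s)) = false.
Proof. by rewrite !sig1_ix eq_lrshift. Qed.

Lemma select22 : J2 *m J2^T = 1%:M.
Proof.
rewrite mul_select_tr; apply/matrixP => r s; rewrite !mxE (eq_sig12 (ix_of2 r)) (eq_sig12 r).
by rewrite !sig2_ix_of2 !sig1_ix eq_lshift.
Qed.
Lemma select33 : J3 *m J3^T = 1%:M.
Proof.
rewrite mul_select_tr; apply/matrixP => r s; rewrite !mxE (eq_sig12 (ix_of3 r)) (eq_sig12 r).
by rewrite !sig2_ix_of3 !sig1_ix eq_rshift.
Qed.
Lemma select23 : J2 *m J3^T = 0.
Proof.
rewrite mul_select_tr; apply/matrixP => r s; rewrite !mxE (eq_sig12 (ix_of2 r)).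
by rewrite sig1_ix_of23.
Qed.
Lemma select32 : J3 *m J2^T = 0.
Proof. by apply: trmx_inj; rewrite trmx_mul trmxK select23 trmx0. Qed.

Lemma select_sum : J2^T *m J2 + J3^T *m J3 = 1%:M.
Proof.
apply/row_matrixP => c; rewrite row1 rowE mulmxDr !mulmxA.
have [[r <-]|[r <-]] := ix_of_cover c; rewrite -row_select -!row_mul.
  by rewrite select22 select23 mul1mx mul0mx row0 addr0.
by rewrite select32 select33 mul1mx mul0mx row0 add0r.
Qed.

(** Inserting the identity [select_sum] leaves two corners of [g]: the diagonal one is the sum of
    the blocks V_2, and the mixed one is 0 since it joins distinct blocks. *)
Lemma select2_sumV : J2 *m g = sumV F (@sizes2 m) *m J2.
Proof.
rewrite -[LHS]mulmx1 -select_sum mulmxDr !mulmxA.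
have -> : J2 *m g *m J2^T = sumV F (@sizes2 m).
  rewrite select_mul mul_select_tr; apply/matrixP => r s; rewrite [LHS]mxE [LHS]mxE !sumVE.
  by rewrite !sig2_ix_of2 !sig1_ix eq_lshift.
have -> : J2 *m g *m J3^T = 0.
  rewrite select_mul mul_select_tr; apply/matrixP => r s; rewrite [LHS]mxE [LHS]mxE [RHS]mxE sumVE.
  by rewrite sig1_ix_of23 addr0.
by rewrite mul0mx addr0.
Qed.

Lemma select3_sumV : J3 *m g = sumV F (@sizes3 l) *m J3.
Proof.
rewrite -[LHS]mulmx1 -select_sum mulmxDr !mulmxA.
have -> : J3 *m g *m J3^T = sumV F (@sizes3 l).
  rewrite select_mul mul_select_tr; apply/matrixP => r s; rewrite [LHS]mxE [LHS]mxE !sumVE.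
  by rewrite !sig2_ix_of3 !sig1_ix eq_rshift.
have -> : J3 *m g *m J2^T = 0.
  rewrite select_mul mul_select_tr; apply/matrixP => r s; rewrite [LHS]mxE [LHS]mxE [RHS]mxE sumVE.
  by rewrite [_ == _]eq_sym sig1_ix_of23 addr0.
by rewrite mul0mx add0r.
Qed.

Lemma invmx_intertwine k n (a : 'M[F]_k) (b : 'M[F]_n) (J : 'M[F]_(k, n)) :
  a \in unitmx -> b \in unitmx -> J *m b = a *m J -> invmx a *m J = J *m invmx b.
Proof.
move=> ua ub Jb; rewrite -[LHS]mulmx1 -(mulmxV ub) !mulmxA; congr (_ *m _).
by rewrite -mulmxA Jb mulmxA mulVmx // mul1mx.
Qed.

Variables (p : nat) (B : 'M[F]_N).
Variables (B2 : 'M[F]_(\sum_(i < m) sizes2 i)) (B3 : 'M[F]_(\sum_(i < l) sizes3 i)).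
Hypotheses (p_pr : prime p) (p2 : (2 < p)%N) (pF : p \in [pchar F]).
Hypotheses (BA : adapted_basis B) (uB2 : B2 \in unitmx) (uB3 : B3 \in unitmx).
Local Notation M := (dual_mx g B).
Local Notation M2 := (dual_mx (sumV F (@sizes2 m)) B2).
Local Notation M3 := (dual_mx (sumV F (@sizes3 l)) B3).

(** [C *m J *m invmx D] is the map [J] written in the bases [C] and [D]; as the dual action involves
    inverses, the intertwining relation is first passed to them. *)
Lemma dual_mx_intertwine k n (a C : 'M[F]_k) (b D : 'M[F]_n) (J : 'M[F]_(k, n)) :
  a \in unitmx -> b \in unitmx -> C \in unitmx -> D \in unitmx -> J *m b = a *m J ->
  dual_mx a C *m (C *m J *m invmx D) = C *m J *m invmx D *m dual_mx b D.
Proof.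
move=> ua ub uC uD Jb; rewrite /dual_mx !mulmxA mulmxKV // mulmxKV //.
by rewrite -(mulmxA C) (invmx_intertwine ua ub Jb) mulmxA.
Qed.

Lemma coinv_tensor23 : exists h : {lrmorphism coinv M -> tensor (coinv M2) (coinv M3)},
  bijective h /\
  forall x, h (coinv_sigma x) =
            tensor_map (@coinv_sigma _ _ M2) (@coinv_sigma _ _ M3) (h x).
Proof.
have uB : B \in unitmx by case: BA.
(* The change to the basis [B] cancels in every composite of an inclusion with a projection. *)
have sandwich k n k' (C : 'M[F]_k) (J : 'M[F]_(k, N)) (K : 'M[F]_(N, k')) (E : 'M[F]_(k', n)) :
    C *m J *m invmx B *m (B *m K *m E) = C *m (J *m K) *m E.
  by rewrite !mulmxA mulmxKV.
(* The witnesses are extension by 0 and restriction of forms, written in the bases [B], [B2] and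
   [B3]. *)
apply: (@coinv_tensor F m l p _ _ M M2 M3 (B2 *m J2 *m invmx B) (B *m J2^T *m invmx B2)
  (B3 *m J3 *m invmx B) (B *m J3^T *m invmx B3)) => //.
- exact: adapted_basis_mx.
- by rewrite sandwich select22 mulmx1 mulmxV.
- by rewrite sandwich select23 mulmx0 mul0mx.
- by rewrite sandwich select32 mulmx0 mul0mx.
- by rewrite sandwich select33 mulmx1 mulmxV.
- rewrite !mulmxA !mulmxKV // -(mulmxA B J2^T) -(mulmxA B J3^T) -mulmxDl -mulmxDr
    select_sum mulmx1.
  by rewrite mulmxV.
- exact: dual_mx_intertwine (sumV_unit _ _) (sumV_unit _ _) uB2 uB select2_sumV.
- exact: dual_mx_intertwine (sumV_unit _ _) (sumV_unit _ _) uB3 uB select3_sumV.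
- pose v := invmx (sumV F (@sizes2 m)).
  have uv : sumV F (@sizes2 m) \in unitmx by apply: sumV_unit.
  (* Multiplying g^2 = 2 g - 1 by v^2, where v is the inverse of g, gives 1 = 2 v - v^2. *)
  have vv : v *m v = v + v - 1%:M.
    have e : v *m v *m (sumV F (@sizes2 m) *m sumV F (@sizes2 m)) = 1%:M.
      by rewrite mulmxA -(mulmxA v v) mulVmx // mulmx1 mulVmx.
    rewrite -e sumV2_mul mulmxBr mulmxDr mulmx1 -!mulmxA mulVmx // mulmx1.
    by rewrite opprB addrCA subrr addr0.
  rewrite /dual_mx -/v !mulmxA mulmxKV // -(mulmxA B2) vv.
  by rewrite mulmxBr mulmxBl mulmxDr mulmxDl mulmx1 mulmxV.
Qed.

End Splitting.

Theorem corollary3p6 (F : fieldType) (p m l : nat)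
    (B : 'M[F]_(dim23 m l))
    (B2 : 'M[F]_(\sum_(i < m) sizes2 i)) (B3 : 'M[F]_(\sum_(i < l) sizes3 i)) :
  prime p -> (2 < p)%N -> p \in [pchar F] -> (0 < l)%N ->
  adapted_basis B -> B2 \in unitmx -> B3 \in unitmx ->
  let M := dual_mx (sumV F (@sizes23 m l)) B in
  let M2 := dual_mx (sumV F (@sizes2 m)) B2 in
  let M3 := dual_mx (sumV F (@sizes3 l)) B3 in
  [/\ reduced_groebner_basis (hilbert_ideal M) (GB F m l p),
      (forall a : 'X_{1..dim23 m l},
         standard_mon (GB F m l p) a <-> divides_top p a) /\
      is_basis (fun _ : coinv M => True) (@divides_top m l p)
        (fun a => to_coinv M 'X_[a]),
      coinv_hilbert_series M
        (('X *+ l + 1) * (\sum_(i < p) 'X^i) ^+ (m + l)) &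
      exists h : {lrmorphism coinv M -> tensor (coinv M2) (coinv M3)},
        bijective h /\
        forall x, h (coinv_sigma x) =
                  tensor_map (@coinv_sigma _ _ M2) (@coinv_sigma _ _ M3) (h x)].
Proof.
move=> p_pr p2 pF l0 BA uB2 uB3 M M2 M3; have p1 := ltnW p2.
have MA := adapted_basis_mx BA; split.
- rewrite GB_GBmon; apply: reduced_groebner_monomials.
    exact: hilbertP p_pr p2 pF MA.
  exact: GBmon_antichain p1.
- split=> [a|].
    by split=> [/standard_monE/(std_divides_top p1 l0)|/(std_divides_top p1 l0)/standard_monE].
  (* The whole algebra corresponds to the trivial restriction on monomials. *)
  apply: (is_basis_ext (W := fun=> True) (P := fun a => std p a /\ True)) => //.
    by move=> a; split=> [[/(std_divides_top p1 l0)]|/(std_divides_top p1 l0)].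
  apply: (coinv_is_basis p_pr p2 pF MA) => x; split=> // _.
  by exists (repr x); rewrite ?to_coinvK.
- exact: (coinv_hilbert_seriesP p_pr p2 pF MA).
- exact: (coinv_tensor23 p_pr p2 pF BA uB2 uB3).
Qed.
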